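(* Let $\mathbf{X}_0$ be a random vector in $\mathbb{R}^d$. For $I\subseteq[d]=\{1,\dots,d\}$ let $q_I=\mathbb{P}\{\operatorname{supp}(\mathbf{X}_0)=I\}$, and for $i\in[d]$ let $\beta_i=\sum_{I\ni i}q_I$; assume $0<\beta_i<1$ for all $i$. Then for every $\mathbf{w}\in\mathbb{R}_{>0}^d$ and every $\tau>0$, $$\overline{\delta}(\mathbf{w})\leq \mathbb{E}_{\mathbf{X}_0}\left[|\operatorname{supp}(\mathbf{X}_0)|\right]+\sum_{j=1}^d\left(\beta_j(\tau w_j)^2+(1-\beta_j)\sqrt{\frac{2}{\pi}}\int_{\tau w_j}^\infty (u-\tau w_j)^2e^{-u^2/2}\,du\right).$$ Moreover, the right-hand side (as a function of $\mathbf{w}\in\mathbb{R}_{>0}^d$ and $\tau>0$) is minimized if the numbers $\lambda_i:=\tau w_i$ satisfy, for every $i\in[d]$, $$\lambda_i\,\frac{\beta_i}{1-\beta_i}=\sqrt{\frac{2}{\pi}}\int_{\lambda_i}^\infty (u-\lambda_i)e^{-u^2/2}\,du.$$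
   Context: Weighted norm: $\|\mathbf{x}\|_1^{\mathbf{w}}=\sum_{i=1}^d w_i|x_i|$ for $\mathbf{w}\in\mathbb{R}_{>0}^d$. Support: $\operatorname{supp}(\mathbf{x})=\{i:x_i\ne0\}$. Descent cone: for convex $f:\mathbb{R}^d\to\mathbb{R}$, $D(f,\mathbf{x}_0)=\operatorname{cone}\{\mathbf{x}-\mathbf{x}_0: f(\mathbf{x})\le f(\mathbf{x}_0)\}$. For $I\subseteq[d]$ write $D(I,\mathbf{w}):=D(\|\cdot\|_1^{\mathbf{w}},\mathbf{x})$, where $\mathbf{x}$ is any vector with nonnegative entries and support $I$ (the cone does not depend on which such $\mathbf{x}$ is chosen; for other vectors with support $I$ the descent cone differs only by sign changes of coordinates, which does not affect $\delta$). Statistical dimension: for a polyhedral cone $C\subseteq\mathbb{R}^d$ let $\pi_C$ be the Euclidean projection onto $C$ and $\mathbf{g}$ a standard normal vector in $\mathbb{R}^d$. The intrinsic volumes are $\nu_k(C)=\mathbb{P}_{\mathbf{g}}\{\pi_C(\mathbf{g})\text{ lies in the relative interior of a }k\text{-dimensional face of }C\}$, $0\le k\le d$, and $\delta(C)=\sum_{k=0}^d k\,\nu_k(C)$; equivalently $\delta(C)=\mathbb{E}_{\mathbf{g}}[\|\pi_C(\mathbf{g})\|_2^2]$. Expected statistical dimension: $\overline{\delta}(\mathbf{w})=\mathbb{E}_{\mathbf{X}_0}[\delta(D(\operatorname{supp}(\mathbf{X}_0),\mathbf{w}))]$. *)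

(* Defs.v *)
From HB Require Import structures.
From mathcomp Require Import all_boot all_order all_algebra.
From mathcomp Require Import all_classical all_reals all_analysis.

Set Implicit Arguments.
Unset Strict Implicit.
Unset Printing Implicit Defensive.

Import Order.TTheory GRing.Theory Num.Theory.
Import numFieldNormedType.Exports.

Local Open Scope classical_set_scope.
Local Open Scope ring_scope.

Section iid_prob.
Context {disp} {T : measurableType disp} {R : realType}.
Variable Q : probability T R.

Definition cons_pair n (p : T * n.-tuple T) : n.+1.-tuple T :=
  [tuple of p.1 :: p.2].

Let measurable_cons_pair n : measurable_fun [set: _] (@cons_pair n).
Proof. exact: measurable_cons. Qed.

HB.instance Definition _ n :=
  isMeasurableFun.Build _ _ _ _ (@cons_pair n) (@measurable_cons_pair n).

(* The n-fold product Q \x ... \x Q. *)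
Fixpoint iid_prob n : probability (n.-tuple T) R :=
  match n with
  | 0 => \d_ [tuple]
  | n'.+1 => distribution (Q \x iid_prob n')%E (@cons_pair n')
  end.

End iid_prob.

Definition std_normal_vec (R : realType) (d : nat) :=
  iid_prob (normal_prob (0 : R) 1) d.

Definition row_of_tuple (R : Type) (d : nat) (t : d.-tuple R) : 'rV[R]_d :=
  \row_i tnth t i.

Section convex_geometry.
Context {R : realType} {d : nat}.
Local Notation V := 'rV[R]_d.
Implicit Types (C F S : set V) (x y z : V).

Definition cone S : set V :=
  [set z | exists n (t : 'I_n -> R) (s : 'I_n -> V),
    [/\ forall i, 0 <= t i, forall i, S (s i) & z = \sum_(i < n) t i *: s i]].

Definition affine_hull S : set V :=
  [set z | exists n (t : 'I_n -> R) (s : 'I_n -> V),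
    [/\ \sum_(i < n) t i = 1, forall i, S (s i) &
        z = \sum_(i < n) t i *: s i]].

Definition has_dim S (k : nat) : Prop :=
  exists (a : V) (U : {vspace V}),
    affine_hull S = [set a + u | u in [set` U]] /\ \dim U = k.

Definition rel_interior S : set V :=
  [set x | S x /\ \forall y \near x, affine_hull S y -> S y].

Definition is_face C F : Prop :=
  [/\ convex_set (F : set (convex_lmodType V)), F `<=` C &
      forall x y (t : R), C x -> C y -> 0 < t < 1 ->
        F (t *: x + (1 - t) *: y) -> F x /\ F y].

(* The norm that MathComp-Analysis puts on 'rV[R]_d is the sup norm. *)
Definition sqnorm2 x : R := \sum_i x 0 i ^+ 2.

Definition euclid_proj C x : V :=
  xget 0 [set p | C p /\ forall y, C y -> sqnorm2 (x - p) <= sqnorm2 (x - y)].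

Definition intrinsic_volume C (k : nat) : R :=
  fine (std_normal_vec R d
    [set g | exists F, [/\ is_face C F, has_dim F k &
                           rel_interior F (euclid_proj C (row_of_tuple g))]]).

Definition stat_dim C : R := \sum_(k < d.+1) k%:R * intrinsic_volume C k.

Definition descent_cone (f : V -> R) x0 : set V :=
  cone [set x - x0 | x in [set x | f x <= f x0]].

Definition wnorm1 (w : V) x : R := \sum_i w 0 i * `|x 0 i|.

Definition supp x : {set 'I_d} := [set i | x 0 i != 0]%SET.

(* descent_coneI_eq below shows that any other vector with nonnegative entries
   and support I may replace the indicator vector of I. *)
Definition descent_coneI (I : {set 'I_d}) (w : V) : set V :=
  descent_cone (wnorm1 w) (\row_i (i \in I)%:R).

End convex_geometry.

Section descent_coneI_theory.
Context {R : realType} {d : nat}.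
Implicit Types (w x y z : 'rV[R]_d).

Let cone_le (S S' : set 'rV[R]_d) :
  (forall s, S s -> exists2 c : R, 0 < c & S' (c *: s)) -> cone S `<=` cone S'.
Proof.
move=> H z [n [t [s [t0 Ss ->]]]].
have /choice[c cP] : forall i, exists c : R, 0 < c /\ S' (c *: s i).
  by move=> i; have [c] := H _ (Ss i); exists c.
exists n, (fun i => t i / c i), (fun i => c i *: s i); split.
- by move=> i; rewrite divr_ge0// ltW//; case: (cP i).
- by move=> i; case: (cP i).
- apply: eq_bigr => i _; rewrite scalerA divfK//.
  by rewrite gt_eqF//; case: (cP i).
Qed.

(* Moving from x' by a small multiple of a descent direction at x is descent. *)
Let descent_le w x x' : (forall i, 0 < w 0 i) ->
  (forall i, 0 <= x 0 i) -> (forall i, 0 <= x' 0 i) -> supp x = supp x' ->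
  descent_cone (wnorm1 w) x `<=` descent_cone (wnorm1 w) x'.
Proof.
move=> w0 x0 x'0 sxx'; apply: cone_le => s [y ys <-{s}].
pose s := y - x.
have eq0 i : (x 0 i == 0) = (x' 0 i == 0).
  by have /setP/(_ i) := sxx'; rewrite !inE => /negb_inj.
pose c := \big[Num.min/1]_i
  (if x' 0 i == 0 then 1 else x' 0 i / (`|s 0 i| + 1)).
have c0 : 0 < c.
  rewrite /c; elim/big_ind: _ => // [a b a0 b0|i _]; first by rewrite lt_min a0.
  case: ifPn => // x'i0; apply: divr_gt0; last by rewrite ltr_wpDl.
  by rewrite lt_neqAle eq_sym x'i0 x'0.
exists c => //; exists (x' + c *: s); last by rewrite addrC addKr.
rewrite /=.
have H : forall i, `|(x' + c *: s) 0 i| - `|x' 0 i|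
    <= c * (`|y 0 i| - `|x 0 i|).
  move=> i; rewrite !mxE (ger0_norm (x'0 i)) (ger0_norm (x0 i)).
  have [x'i0|x'i0] := eqVneq (x' 0 i) 0.
    have /eqP xi0 : x 0 i == 0 by rewrite eq0 x'i0.
    by rewrite x'i0 xi0 oppr0 !addr0 add0r normrM (gtr0_norm c0).
  have cs : c * `|s 0 i| <= x' 0 i.
    have : c <= x' 0 i / (`|s 0 i| + 1).
      by rewrite /c (bigminD1 i)//= (negbTE x'i0) ge_min lexx.
    rewrite ler_pdivlMr ?ltr_wpDl// => /(le_trans _); apply.
    by rewrite ler_pM2l// lerDl.
  rewrite ger0_norm; last first.
    have : - (c * s 0 i) <= x' 0 i.
      by apply: le_trans (ler_norm _) _; rewrite normrN normrM (gtr0_norm c0).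
    by rewrite /s !mxE lerNl -subr_ge0 opprK (addrC (x' 0 i)).
  rewrite addrAC subrr add0r ler_pM2l// lerB//.
  exact: ler_norm.
rewrite -subr_le0 /wnorm1 -sumrB.
apply: (@le_trans _ _ (c * \sum_i w 0 i * (`|y 0 i| - `|x 0 i|))).
  rewrite mulr_sumr; apply: ler_sum => i _.
  by rewrite -mulrBr mulrCA ler_pM2l.
rewrite pmulr_rle0//; under eq_bigr do rewrite mulrBr.
by rewrite sumrB subr_le0.
Qed.

Lemma descent_coneI_eq w x : (forall i, 0 < w 0 i) -> (forall i, 0 <= x 0 i) ->
  descent_cone (wnorm1 w) x = descent_coneI (supp x) w.
Proof.
move=> w0 x0.
have ind0 i : 0 <= (\row_i (i \in supp x)%:R : 'rV[R]_d) 0 i.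
  by rewrite mxE ler0n.
have sE : supp x = supp (\row_i (i \in supp x)%:R : 'rV[R]_d).
  by apply/setP => i; rewrite !inE mxE inE; case: eqP; rewrite ?eqxx ?oner_eq0.
by apply/seteqP; split; exact: descent_le.
Qed.

End descent_coneI_theory.

Section random_support.
Context {R : realType} {d : nat} {disp : measure_display}
  {Omega : measurableType disp}.
Variables (P : probability Omega R) (X0 : {RV P >-> d.-tuple R}).

Definition supp_rv (omega : Omega) : {set 'I_d} := supp (row_of_tuple (X0 omega)).

Definition prob_supp (I : {set 'I_d}) : R := fine (P (supp_rv @^-1` [set I])).

Definition beta (i : 'I_d) : R := \sum_(I : {set 'I_d} | i \in I) prob_supp I.

Definition expected_stat_dim (w : 'rV[R]_d) : \bar R :=
  'E_P[fun omega => stat_dim (descent_coneI (supp_rv omega) w)].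

Definition upper_bound (w : 'rV[R]_d) (tau : R) : \bar R :=
  ('E_P[fun omega => #|supp_rv omega|%:R] +
   (\sum_(j < d)
      (beta j * (tau * w 0 j) ^+ 2 +
       (1 - beta j) * (Num.sqrt (2 / pi) *
         \int[lebesgue_measure]_(u in `[(tau * w 0 j)%R, +oo[)
            ((u - tau * w 0 j) ^+ 2 * expR (- (u ^+ 2) / 2)))%R))%:E)%E.

End random_support.

(* Main.v *)
Require Import Defs.
From HB Require Import structures.
From mathcomp Require Import all_boot all_order all_algebra.
From mathcomp Require Import all_classical all_reals all_analysis.
From mathcomp Require Import measurable_realfun ring lra.

Set Implicit Arguments.
Unset Strict Implicit.
Unset Printing Implicit Defensive.

Import Order.TTheory GRing.Theory Num.Theory.
Import numFieldNormedType.Exports.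

Local Open Scope classical_set_scope.
Local Open Scope ring_scope.

(** Let [C] be the descent cone of the weighted norm at a vector with support
    [I], let [g] be a standard Gaussian vector and [proj] the projection onto
    [C]. The bound is weak duality: since [g - proj g] is orthogonal to
    [proj g], every point [u] of the polar cone of [C] satisfies
    [|proj g| <= |g - u|] ([sqnorm2_proj_le_dist_polar]). The multiples by
    [tau] of the subgradients of the norm lie in the polar cone, and the one
    closest to [g] has coordinates [tau w_i] on [I] and [g_i] truncated to
    [[-tau w_i, tau w_i]] elsewhere ([subgradient_polar]). The squared distance
    splits into functions of single coordinates, whose Gaussian means are
    [1 + (tau w_i)^2] and twice a truncated second moment
    ([stat_dim_descent_coneI_le]); averaging over [I] gives the right-hand side.

    This presupposes that the statistical dimension, defined by intrinsic
    volumes, is at most [E |proj g|^2] ([stat_dim_le_sqnorm2_proj]), which is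
    proved for every polyhedral cone. The intrinsic volumes average the
    dimension of the face that contains [proj g] in its relative interior. The
    span of that face consists of the directions in which one can move from
    [proj g] both ways inside the cone ([rel_interior_face_dim]), and its
    dimension is the trace of the orthogonal projector onto it. Moving [g] by a
    small [h v] moves [proj g] in that span exactly by the projection of [h v],
    so firm nonexpansiveness yields, for every [g] and all small [h > 0],
      [h * dim <= \sum_i (proj (g + h e_i) - proj g)_i]
    ([proj_divergence]). This inequality at every point stands in for the almost
    everywhere identity between the dimension and the divergence of [proj]. By
    the Cameron-Martin formula the mean of the right-hand side divided
    by [h] tends to [E <g, proj g> = E |proj g|^2] ([stein_difference]), and
    Fatou's lemma concludes.

    For the second claim, the right-hand side is a sum of functions of the
    single numbers [lambda_j = tau w_j], each of them convex, and the equation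
    for [lambda_j] says that the derivative vanishes. Convexity is used in the
    form of the tangent line inequality for [max(u - l, 0)^2], integrated over
    [u] ([truncated_moment_tangent]). *)

(** * Euclidean geometry of row vectors *)

Section dot.
Context {R : realType} {d : nat}.
Implicit Types (x y z u v : 'rV[R]_d) (M : 'M[R]_d).

Definition dot x y : R := (x *m y^T) 0 0.

Lemma dotE x y : dot x y = \sum_i x 0 i * y 0 i.
Proof. by rewrite /dot mxE; apply: eq_bigr => i _; rewrite mxE. Qed.

Lemma dotC x y : dot x y = dot y x.
Proof. by rewrite !dotE; apply: eq_bigr => i _; rewrite mulrC. Qed.

Lemma dotDl x y z : dot (x + y) z = dot x z + dot y z.
Proof. by rewrite /dot mulmxDl mxE. Qed.

Lemma dotNl x y : dot (- x) y = - dot x y.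
Proof. by rewrite /dot mulNmx mxE. Qed.

Lemma dotZl a x y : dot (a *: x) y = a * dot x y.
Proof. by rewrite /dot -scalemxAl mxE. Qed.

Lemma dotDr x y z : dot z (x + y) = dot z x + dot z y.
Proof. by rewrite dotC dotDl !(dotC _ z). Qed.

Lemma dotNr x y : dot y (- x) = - dot y x.
Proof. by rewrite dotC dotNl dotC. Qed.

Lemma dotZr a x y : dot y (a *: x) = a * dot y x.
Proof. by rewrite dotC dotZl dotC. Qed.

Definition dotL := (dotDl, dotDr, dotNl, dotNr, dotZl, dotZr).

Lemma dot_mxr x M y : dot (x *m M) y = dot x (y *m M^T).
Proof. by rewrite /dot trmx_mul trmxK mulmxA. Qed.

Lemma sqnorm2_dot x : sqnorm2 x = dot x x.
Proof. by rewrite dotE; apply: eq_bigr => i _; rewrite expr2. Qed.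

Lemma dot_ge0 x : 0 <= dot x x.
Proof. by rewrite -sqnorm2_dot; apply: sumr_ge0 => i _; exact: sqr_ge0. Qed.

Lemma dot_eq0 x : (dot x x == 0) = (x == 0).
Proof.
apply/eqP/eqP => [|->]; last by rewrite /dot mul0mx mxE.
rewrite -sqnorm2_dot => /eqP.
rewrite psumr_eq0 => [/allP x0|i _]; last exact: sqr_ge0.
apply/rowP => i; have := x0 i (mem_index_enum _).
by rewrite sqrf_eq0 mxE => /eqP.
Qed.

Lemma coord_dot x i : x 0 i = dot x (delta_mx 0 i).
Proof.
rewrite dotE (bigD1 i)//= !mxE !eqxx mulr1 big1 ?addr0// => j ji.
by rewrite !mxE (negbTE ji) andbF mulr0.
Qed.

Lemma normr_coord_le x i : `|x 0 i| <= Num.sqrt (dot x x).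
Proof.
rewrite -sqrtr_sqr ler_wsqrtr// -sqnorm2_dot /sqnorm2 (bigD1 i)//=.
by rewrite lerDl sumr_ge0// => j _; exact: sqr_ge0.
Qed.

(** With [B] a matrix whose rows form a basis of the subspace, the projector is
    [B^T (B B^T)^-1 B]; the Gram matrix [B B^T] is invertible because the form
    is definite, and cyclicity of the trace gives [\tr (B B^T)^-1 B B^T]. *)
Lemma orthogonal_projector (U : {vspace 'rV[R]_d}) :
  exists P : 'M[R]_d, [/\ P^T = P, P *m P = P, \tr P = (\dim U)%:R &
    forall x, (forall u, u \in U -> dot x u = 0) -> x *m P = 0].
Proof.
pose B : 'M[R]_(\dim U, d) := \matrix_(i, j) (vbasis U)`_i 0 j.
have rowB (c : 'rV[R]_(\dim U)) : c *m B = \sum_(i < \dim U) c 0 i *: (vbasis U)`_i.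
  apply/rowP => j; rewrite mxE summxE; apply: eq_bigr => i _.
  by rewrite !mxE.
have B_free (c : 'rV[R]_(\dim U)) : c *m B = 0 -> c = 0.
  rewrite rowB => c0; apply/rowP => i; rewrite mxE.
  by have /freeP := basis_free (vbasisP U); apply.
pose G := B *m B^T.
have GU : G \in unitmx.
  rewrite -row_free_unit -kermx_eq0; apply/rowV0P => c /sub_kermxP cG.
  apply: B_free; apply/eqP; rewrite -dot_eq0 /dot trmx_mul mulmxA.
  by rewrite -(mulmxA c) -/G cG mul0mx mxE.
have GT : G^T = G by rewrite /G trmx_mul trmxK.
exists (B^T *m invmx G *m B); split.
- by rewrite !trmx_mul trmxK trmx_inv GT mulmxA.
- rewrite !mulmxA -(mulmxA _ B B^T) -/G -(mulmxA _ _ G).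
  by rewrite mulVmx// mulmx1.
- by rewrite mxtrace_mulC mulmxA -/G mulmxV// mxtrace1.
- move=> x xU; suff xB : x *m B^T = 0 by rewrite !mulmxA xB !mul0mx.
  apply/rowP => i; rewrite !mxE -[RHS](xU ((vbasis U)`_i)).
    by rewrite dotE; apply: eq_bigr => j _; rewrite !mxE.
  by apply: vbasis_mem; rewrite mem_nth// size_tuple.
Qed.

Lemma projector_contraction M x : M^T = M -> M *m M = M ->
  dot (x *m M) (x *m M) <= dot x x.
Proof.
move=> MT MM; have := dot_ge0 (x - x *m M).
rewrite !dotL (dotC (x *m M) x) (dot_mxr x M (x *m M)) MT -mulmxA MM; lra.
Qed.

End dot.

(** * Projection onto a polyhedral cone *)

Section polyhedral_cone.
Context {R : realType} {d m : nat} (A : 'M[R]_(d, m)).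
Local Notation V := 'rV[R]_d.
Implicit Types (x y p u v : V).

Definition polycone : set V := [set z | forall j, (z *m A) 0 j <= 0].

(** The common kernel of the constraints that [x] satisfies with equality. For
    [x] in the cone it is the lineality space of the tangent cone at [x]. *)
Definition active x : {vspace V} :=
  lker (linfun (mulmxr (\matrix_(i < d, j < m) (((x *m A) 0 j == 0)%:R * A i j)))).

Lemma memv_active x v :
  reflect (forall j, (x *m A) 0 j = 0 -> (v *m A) 0 j = 0) (v \in active x).
Proof.
have E j : (v *m \matrix_(i < d, j < m) (((x *m A) 0 j == 0)%:R * A i j)) 0 j =
    ((x *m A) 0 j == 0)%:R * (v *m A) 0 j.
  rewrite mxE [X in _ = _ * X]mxE mulr_sumr; apply: eq_bigr => i _.
  by rewrite mxE mulrCA.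
rewrite memv_ker lfunE /=; apply: (iffP eqP) => [/rowP v0 j xj|v0].
  by have := v0 j; rewrite E xj eqxx mul1r => ->; rewrite mxE.
apply/rowP => j; rewrite E [RHS]mxE.
by case: eqP => [/v0->|]; rewrite ?mulr0 ?mul0r.
Qed.

Lemma active_id x : x \in active x.
Proof. by apply/memv_active. Qed.

Lemma polycone_mulmxE x v (s : R) j :
  ((x + s *: v) *m A) 0 j = (x *m A) 0 j + s * (v *m A) 0 j.
Proof. by rewrite mulmxDl -scalemxAl mxE [X in _ + X]mxE. Qed.

Lemma polycone0 : polycone 0.
Proof. by move=> j; rewrite mul0mx mxE. Qed.

Lemma polyconeD x y (a b : R) : 0 <= a -> 0 <= b ->
  polycone x -> polycone y -> polycone (a *: x + b *: y).
Proof.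
move=> a0 b0 Cx Cy j; rewrite mulmxDl -!scalemxAl mxE.
rewrite [X in X + _]mxE [X in _ + X]mxE -[0 in leRHS]addr0.
by rewrite lerD// mulr_ge0_le0.
Qed.

Lemma polyconeZ (a : R) x : 0 <= a -> polycone x -> polycone (a *: x).
Proof. by move=> a0 /(polyconeD a0 (lexx 0)) /(_ polycone0); rewrite scaler0 addr0. Qed.

Lemma continuous_mulmx_coord j : continuous (fun x => (x *m A) 0 j).
Proof.
rewrite (_ : (fun _ => _) = fun x => \sum_k x 0 k * A k j); last first.
  by apply/funext => y; rewrite mxE.
apply: continuous_big => [|k _ x]; first exact: add_continuous.
by apply: (@cvgMl _ _ (nbhs x)); exact: coord_continuous.
Qed.

Lemma continuous_sqnorm2B x : continuous (fun y : V => sqnorm2 (x - y) : R).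
Proof.
apply: continuous_big => [|k _ y]; first exact: add_continuous.
have h : z 0 k @[z --> y] --> y 0 k by exact: coord_continuous.
rewrite /continuous_at (_ : (fun _ => _) = fun z : V => (x 0 k - z 0 k) ^+ 2); last first.
  by apply/funext => z; rewrite !mxE.
have xh : x 0 k - z 0 k @[z --> y] --> x 0 k - y 0 k.
  by apply: (@cvgB _ R^o _ (nbhs y)) => //; exact: cvg_cst.
rewrite [X in _ --> X](_ : _ = (x 0 k - y 0 k) ^+ 2); last by rewrite !mxE.
exact: (@cvgM _ _ (nbhs y) _ _ _ _ _ xh xh).
Qed.

Lemma closed_polycone : closed polycone.
Proof.
rewrite (_ : polycone = \bigcap_(j in setT) [set x | (x *m A) 0 j <= 0]).
  apply: closed_bigI => j _.
  apply: (@preimage_closed V R (fun x => (x *m A) 0 j) [set r : R | r <= 0]);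
    last exact: (@closed_le R 0).
  by move=> x _; exact: continuous_mulmx_coord.
by apply/seteqP; split => [x Cx j _|x Cx j]; [exact: Cx|exact: Cx].
Qed.

Lemma near_inactive p : \forall y \near p,
  forall j, (p *m A) 0 j != 0 -> (y *m A) 0 j != 0.
Proof.
apply: (@filter_forall _ _ (fun j y => (p *m A) 0 j != 0 -> (y *m A) 0 j != 0)
  (nbhs p)) => j /=; have [pj|pj] := eqVneq ((p *m A) 0 j) 0.
  exact: nearW.
near=> y => _; near: y.
apply: (@continuous_mulmx_coord j p [set r | r != 0]).
by apply: open_nbhs_nbhs; split => //; exact: open_neq.
Unshelve. all: by end_near. Qed.

Lemma near_polycone p : polycone p ->
  \forall y \near p, (forall j, (p *m A) 0 j = 0 -> (y *m A) 0 j <= 0) ->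
    polycone y.
Proof.
move=> Cp; suff: \forall y \near p, forall j, (p *m A) 0 j != 0 -> (y *m A) 0 j <= 0.
  apply: filterS => y yA yA0 j; have [/yA0//|] := eqVneq ((p *m A) 0 j) 0.
  exact: yA.
apply: (@filter_forall _ _ (fun j y => (p *m A) 0 j != 0 -> (y *m A) 0 j <= 0)
  (nbhs p)) => j /=; have [pj|pj] := eqVneq ((p *m A) 0 j) 0.
  exact: nearW.
near=> y => _; apply: ltW; near: y.
apply: (@continuous_mulmx_coord j p [set r | r < 0]).
by apply: open_nbhs_nbhs; split; [exact: open_lt|rewrite /= lt_neqAle pj Cp].
Unshelve. all: by end_near. Qed.

Lemma near_line p v (P : set V) : (\forall y \near p, P y) ->
  exists2 s : R, 0 < s & forall t, `|t| <= s -> P (p + t *: v).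
Proof.
move=> nP; have : \forall t \near (0 : R), P (p + t *: v).
  have h : p + t *: v @[t --> (0 : R)] --> p.
    rewrite -[X in _ --> X]addr0 -(scale0r v).
    by apply: cvgD; [exact: cvg_cst|apply: cvgZl; exact: cvg_id].
  exact: h nP.
move=> /nbhs_ballP[e /= e0 eP]; exists (e / 2); first by rewrite divr_gt0.
move=> t te; apply: eP; rewrite /ball/= sub0r normrN (le_lt_trans te)//.
by rewrite ltr_pdivrMr// mulr_natr mulr2n ltrDl.
Qed.

Lemma active_segment p v : polycone p -> v \in active p ->
  exists2 s : R, 0 < s & forall t, `|t| <= s -> polycone (p + t *: v).
Proof.
move=> Cp /memv_active pv; have [s s0 sC] := near_line v (near_polycone Cp).
exists s => // t ts; apply: sC => // j pj.
by rewrite polycone_mulmxE pj pv// mulr0 addr0.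
Qed.

Lemma segment_active p v (s : R) : 0 < s -> polycone (p + s *: v) ->
  polycone (p - s *: v) -> v \in active p.
Proof.
move=> s0 Cp Cm; apply/memv_active => j pj; apply/eqP; rewrite eq_le.
have := Cp j; have := Cm j; rewrite -scaleNr !polycone_mulmxE pj !add0r.
by rewrite mulNr oppr_le0 !(pmulr_rge0, pmulr_rle0)// => -> ->.
Qed.

(** The face containing [p] in its relative interior consists of the points of
    the cone satisfying with equality every constraint that [p] does, and it
    spans [active p]. Any other face through [p] as a relative interior point
    has the same direction space, since both spaces consist of the directions
    in which one can move from [p] both ways inside the cone. *)
Lemma rel_interior_face_dim p k : polycone p ->
  (exists F, [/\ is_face polycone F, has_dim F k & rel_interior F p]) <->
  \dim (active p) = k.
Proof.
move=> Cp; split.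
  move=> [F [[_ FC faceF] [a [U [affF <-]]] [Fp nFp]]].
  have subF x : F x -> affine_hull F x.
    move=> Fx; exists 1, (fun=> 1), (fun=> x); split => //.
      by rewrite big_ord1.
    by rewrite big_ord1 scale1r.
  have /= [u0 u0U pE] : [set a + u | u in [set` U]] p by rewrite -affF; exact: subF.
  congr (\dim _); apply/vspaceP => v; apply/idP/idP => [vp|vU].
    have [s s0 sC] := active_segment Cp vp.
    have [||||] := faceF (p + s *: v) (p - s *: v) (2^-1).
    - by apply: sC; rewrite gtr0_norm.
    - by rewrite -scaleNr; apply: sC; rewrite normrN gtr0_norm.
    - by rewrite invr_gt0 ltr0n invf_lt1 ?ltr1n.
    - rewrite [X in F X](_ : _ = p)//; apply/rowP => i; rewrite !mxE.
      by field.
    move=> /subF; rewrite affF => -[u uU] /= uE _.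
    have : s *: v = u - u0.
      apply: (addrI p); rewrite -uE -[in RHS]pE -addrA (addrCA u0).
      by rewrite subrr addr0.
    move=> /(congr1 ( *:%R s^-1)); rewrite scalerA mulVf ?gt_eqF// scale1r => ->.
    by rewrite memvZ// memvB.
  have [s s0 sF] := near_line v nFp.
  apply: (segment_active s0); apply: FC; last rewrite -scaleNr; apply: sF;
    rewrite ?normrN ?gtr0_norm// affF.
  - by exists (u0 + s *: v); [rewrite /= memvD// memvZ|rewrite addrA pE].
  - by exists (u0 + (- s) *: v); [rewrite /= memvD// memvZ|rewrite addrA pE].
move=> <-; pose F := [set z | polycone z /\ z \in active p].
have affF : affine_hull F = [set` active p].
  apply/seteqP; split => [_ [n [t [s [_ sF ->]]]]|v vp].
    by apply: memv_suml => i _; apply: memvZ; case: (sF i).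
  have vpp : v - p \in active p by rewrite memvB// active_id.
  have [s s0 sC] := active_segment Cp vpp.
  exists 2, (fun i => if i == 0 then 1 - s^-1 else s^-1),
    (fun i => if i == 0 then p else p + s *: (v - p)); split.
  - by rewrite big_ord_recl big_ord1/= subrK.
  - move=> i; case: ifPn => _; first by split => //; exact: active_id.
    split; first by apply: sC; rewrite gtr0_norm.
    by rewrite memvD ?memvZ// active_id.
  - rewrite big_ord_recl big_ord1/= scalerDr scalerA mulVf ?gt_eqF//.
    by rewrite scale1r addrA -scalerDl subrK scale1r addrC subrK.
exists F; split.
- split; last first.
  + move=> x y t Cx Cy /andP[t0 t1] [_ /memv_active xyp].
    suff xy j : (p *m A) 0 j = 0 -> (x *m A) 0 j = 0 /\ (y *m A) 0 j = 0.
      by split; split => //; apply/memv_active => j /xy[].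
    move=> /xyp /eqP; rewrite mulmxDl -!scalemxAl mxE.
    rewrite [X in X + _]mxE [X in _ + X]mxE => /eqP.
    have := Cx j; have := Cy j; move: ((x *m A) 0 j) ((y *m A) 0 j) => a b.
    move=> b0 a0 ab.
    have ta0 : t * a <= 0 by rewrite mulr_ge0_le0// ltW.
    have tb0 : (1 - t) * b <= 0 by rewrite mulr_ge0_le0// subr_ge0 ltW.
    have /eqP : t * a = 0 by lra.
    have /eqP : (1 - t) * b = 0 by lra.
    rewrite !mulf_eq0 subr_eq0 (gt_eqF t0) (gt_eqF t1)/=.
    by move=> /eqP-> /eqP->.
  + by move=> x [].
  + move=> x y t; rewrite !inE => -[Cx xp] [Cy yp]; split.
      have t1 : 0 <= 1 - t%:num :> R by rewrite subr_ge0.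
      have t0 : 0 <= t%:num :> R by [].
      exact: (polyconeD t0 t1 Cx Cy).
    by rewrite memvD// memvZ.
- exists 0, (active p); split => //; rewrite affF; apply/seteqP; split => x.
    by move=> xp; exists x => //; rewrite add0r.
  by move=> [u up <-]; rewrite add0r.
- split; first by split => //; exact: active_id.
  apply: filterS (near_polycone Cp) => y Cy; rewrite affF => yp; split => //.
  by apply: Cy => j; have /memv_active/(_ j)/[apply] -> := yp.
Qed.

Local Notation proj := (euclid_proj polycone).

(** Only the points of the cone that are at least as close to [x] as the apex
    matter, and they form a compact set; hence a closest point exists and
    [euclid_proj] never takes its default value. *)
Lemma projP x : polycone (proj x) /\
  forall y, polycone y -> sqnorm2 (x - proj x) <= sqnorm2 (x - y).
Proof.
suff : exists p, polycone p /\ forall y, polycone y -> sqnorm2 (x - p) <= sqnorm2 (x - y).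
  rewrite /euclid_proj => -[p pP].
  by case: xgetP => [? ->//|/(_ p)].
pose K := polycone `&` [set y | sqnorm2 (x - y) <= sqnorm2 x].
have K0 : K 0 by split; [exact: polycone0|rewrite /= subr0].
have cK : compact K.
  apply: bounded_closed_compact.
    pose M := `|x| + Num.sqrt (sqnorm2 x).
    exists M; split; first exact: num_real.
    move=> r Mr y [_ /= yx]; rewrite (le_trans _ (ltW Mr))//.
    rewrite -[y in leLHS](subKr x) (le_trans (ler_normB _ _))// lerD2l.
    rewrite [leLHS]/Num.norm/= mx_normrE; apply/bigmax_leP; split => //= -[i j] _.
    rewrite [i]ord1 /=; apply: le_trans (normr_coord_le _ _) _.
    by rewrite ler_wsqrtr// -sqnorm2_dot.
  apply: closedI; first exact: closed_polycone.
  apply: (@preimage_closed V R (fun y : V => sqnorm2 (x - y) : R)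
    [set r : R | r <= sqnorm2 x]); last exact: (@closed_le R).
  by move=> y _; exact: continuous_sqnorm2B.
have [||p /set_mem[Cp px] minp] :=
    @compact_EVT_min _ _ (fun y : V => sqnorm2 (x - y) : R) K _ cK.
- by exists 0.
- by apply: continuous_subspaceT => y; exact: continuous_sqnorm2B.
exists p; split => // y Cy.
have [yx|/ltW yx] := leP (sqnorm2 (x - y)) (sqnorm2 x).
  by apply: minp; rewrite inE.
exact: le_trans px yx.
Qed.

Lemma proj_polycone x : polycone (proj x). Proof. by case: (projP x). Qed.

(** First-order optimality along the segment from [p] to [p + c]. *)
Lemma minimal_direction x p c : (forall t : R, 0 < t -> t <= 1 ->
    sqnorm2 (x - p) <= sqnorm2 (x - (p + t *: c))) -> dot (x - p) c <= 0.
Proof.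
move=> H; rewrite leNgt; apply/negP => b0; set b := dot _ _ in b0.
have c0 : 0 <= dot c c by exact: dot_ge0.
(* Close to the minimizer [b / |c|^2] of the quadratic in [t], but at most 1. *)
pose t := b / (b + dot c c).
have bc : 0 < b + dot c c by rewrite ltr_pwDl.
have t0 : 0 < t by rewrite divr_gt0.
have t1 : t <= 1 by rewrite ler_pdivrMr// mul1r lerDl.
have tE : t * (b + dot c c) = b by rewrite /t divfK// gt_eqF.
have := H t t0 t1; rewrite opprD addrA !sqnorm2_dot.
rewrite (dotDl (x - p)) !(dotDr (x - p)) dotDr !dotNl !dotNr !dotZl !dotZr.
rewrite (dotC c) -/b => le.
have : 2 * b <= t * dot c c by rewrite -(ler_pM2l t0); lra.
nra.
Qed.

(** Moreau's decomposition: the residual [x - proj x] is orthogonal to [proj x]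
    and lies in the polar cone. *)
Lemma proj_variational x : dot (x - proj x) (proj x) = 0 /\
  forall c, polycone c -> dot (x - proj x) c <= 0.
Proof.
have [Cp minp] := projP x; set p := proj x in Cp minp *.
have pol c : polycone c -> dot (x - p) c <= 0.
  move=> Cc; apply: minimal_direction => t t0 _; apply: minp.
  by rewrite -[p]scale1r; apply: polyconeD => //; exact: ltW.
split => //; apply/eqP; rewrite eq_le pol//= -oppr_le0 -dotNr.
apply: minimal_direction => t t0 t1; apply: minp.
have -> : p + t *: - p = (1 - t) *: p by rewrite scalerN scalerBl scale1r.
by apply: polyconeZ => //; rewrite subr_ge0.
Qed.

Lemma sqnorm2_proj x : sqnorm2 (proj x) = dot x (proj x).
Proof.
have [/eqP + _] := proj_variational x.
by rewrite !dotL subr_eq0 sqnorm2_dot => /eqP.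
Qed.

(** Weak duality: each point of the polar cone gives an upper bound on the
    squared length of the projection. *)
Lemma sqnorm2_proj_le_dist_polar x u : (forall c, polycone c -> dot u c <= 0) ->
  sqnorm2 (proj x) <= sqnorm2 (x - u).
Proof.
move=> /(_ _ (proj_polycone x)) up.
have [+ _] := proj_variational x; move: up.
set p := proj x => up; rewrite !dotL => xp.
have := dot_ge0 (x - u - p); rewrite !sqnorm2_dot !dotL (dotC p) (dotC p u).
lra.
Qed.

Lemma proj_firm x y :
  sqnorm2 (proj x - proj y) <= dot (x - y) (proj x - proj y).
Proof.
have [xx /(_ _ (proj_polycone y)) xy] := proj_variational x.
have [yy /(_ _ (proj_polycone x)) yx] := proj_variational y.
move: xx xy yy yx; rewrite sqnorm2_dot !dotL (dotC (proj y) (proj x)).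
by move=> h1 h2 h3 h4; lra.
Qed.

Lemma proj_nonexpansive x y : sqnorm2 (proj x - proj y) <= sqnorm2 (x - y).
Proof.
have := proj_firm x y; have := dot_ge0 (x - y - (proj x - proj y)).
move: (x - y) (proj x - proj y) => u q.
by rewrite !sqnorm2_dot !dotL (dotC q); lra.
Qed.

(** Both [proj x + s u] and [proj x - s u] are in the cone for some [s > 0], so
    the inequality against the polar cone holds with both signs. *)
Lemma proj_residual_orthogonal x u :
  u \in active (proj x) -> dot (x - proj x) u = 0.
Proof.
move=> /(active_segment (proj_polycone x))[s s0 sC].
have [xp pol] := proj_variational x.
have := pol _ (sC s _); have := pol _ (sC (- s) _).
rewrite normrN gtr0_norm// lexx => /(_ isT) + /(_ isT).
rewrite !dotDr !dotZr xp !add0r mulNr oppr_le0 => h1 h2.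
apply/eqP; rewrite -(mulrI_eq0 _ (lregP (lt0r_neq0 s0))).
by rewrite eq_le h2.
Qed.

Lemma continuous_proj : continuous proj.
Proof.
move=> x; suff : proj y @[y --> x] --> proj x by [].
apply/(@cvgrPdist_le _ _ _ _ (nbhs_filter x)) => /= e e0.
have : \forall y \near x, sqnorm2 (x - y) < e ^+ 2.
  apply: (@continuous_sqnorm2B x x [set r | r < e ^+ 2]).
  apply: open_nbhs_nbhs; split; first exact: open_lt.
  by rewrite /= subrr sqnorm2_dot /dot mul0mx mxE exprn_gt0.
apply: (@filterS _ (nbhs x)) => y ye.
rewrite [leLHS]/Num.norm/= mx_normrE; apply/bigmax_leP; split => /=; first exact: ltW.
move=> [i j] _ /=; rewrite [i]ord1; apply: le_trans (normr_coord_le _ _) _.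
rewrite -(ger0_norm (ltW e0)) -sqrtr_sqr ler_wsqrtr// -sqnorm2_dot.
exact: le_trans (proj_nonexpansive _ _) (ltW ye).
Qed.

Lemma continuous_at_proj x v : proj (x + h *: v) @[h --> (0 : R)] --> proj x.
Proof.
have h : x + t *: v @[t --> (0 : R)] --> x.
  rewrite -[X in _ --> X]addr0 -(scale0r v).
  by apply: cvgD; [exact: cvg_cst|apply: cvgZl; exact: cvg_id].
exact: (cvg_comp _ _ h (@continuous_proj x)).
Qed.

(** Near [proj x] every inactive constraint stays inactive, so that both
    residuals are orthogonal to [active (proj x)]. Hence the component of
    [proj (x + h v) - proj x] in that subspace is exactly that of [h v], and
    firm nonexpansiveness bounds the increment in the direction [v] below. *)
Lemma proj_growth x (P : 'M[R]_d) v : P^T = P -> P *m P = P ->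
  (forall z, (forall u, u \in active (proj x) -> dot z u = 0) -> z *m P = 0) ->
  \forall h \near (0 : R)^'+,
    h * dot (v *m P) (v *m P) <= dot v (proj (x + h *: v) - proj x).
Proof.
move=> PT PP PU; near=> h.
have h0 : 0 < h by near: h; exact: nbhs_right_gt.
set q := proj (x + h *: v) - proj x.
have qP : q *m P = h *: (v *m P).
  have /eqP : (h *: v - q) *m P = 0.
    apply: PU => u uU.
    have xu := proj_residual_orthogonal uU.
    have : dot (x + h *: v - proj (x + h *: v)) u = 0.
      apply: proj_residual_orthogonal; apply/memv_active => j yj.
      apply: (memv_active _ _ uU); apply/eqP/negPn; apply/negP => xj.
      move/eqP: yj; apply/negP; move: j xj; near: h.
      apply: cvg_at_right_filter (near_inactive (proj x)).
      exact: continuous_at_proj.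
    by move: xu; rewrite /q !dotL; lra.
  by rewrite mulmxBl -scalemxAl subr_eq0 => /eqP.
have := projector_contraction q PT PP.
have := proj_firm (x + h *: v) x; rewrite -/q addrC addKr dotZl sqnorm2_dot.
rewrite qP dotZl dotZr => h1 h2.
by rewrite -(ler_pM2l h0) (le_trans h2).
Unshelve. all: by end_near. Qed.

(** Summing [proj_growth] over the coordinate directions produces the trace of
    the projector, that is, the dimension. *)
Lemma proj_divergence x : \forall h \near (0 : R)^'+,
  h * (\dim (active (proj x)))%:R <=
  \sum_i (proj (x + h *: delta_mx 0 i) 0 i - proj x 0 i).
Proof.
have [P [PT PP trP PU]] := orthogonal_projector (active (proj x)).
have : \forall h \near (0 : R)^'+, forall i, h * P i i <=
    proj (x + h *: delta_mx 0 i) 0 i - proj x 0 i.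
  apply: (@filter_forall _ _ (fun i h => h * P i i <= _)) => i.
  apply: filterS (proj_growth (delta_mx 0 i) PT PP PU) => h.
  rewrite dot_mxr PT -mulmxA PP dotC -coord_dot -rowE mxE => /le_trans; apply.
  by rewrite dotC -coord_dot !mxE.
apply: filterS => h hP; rewrite -trP /mxtrace mulr_sumr.
exact: ler_sum.
Qed.

End polyhedral_cone.

(** * Integration against a density, and translation of the Gaussian *)

Section density.
Local Open Scope ereal_scope.
Context {disp} {T : measurableType disp} {R : realType}.
Variables (mu nu : {measure set T -> \bar R}) (p : T -> R).
Hypothesis p0 : forall x, (0 <= p x)%R.
Hypothesis mp : measurable_fun setT p.
Hypothesis nuE : forall B, measurable B -> nu B = \int[mu]_(x in B) (p x)%:E.

Import HBNNSimple.

Let integral_density_nnsfun (f : {nnsfun T >-> R}) :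
  \int[nu]_x (f x)%:E = \int[mu]_x ((f x)%:E * (p x)%:E).
Proof.
under [LHS]eq_integral do rewrite fimfunE -fsumEFin//.
rewrite [LHS]ge0_integral_fsum//; last 2 first.
- by move=> r; exact/measurable_EFinP/measurableT_comp.
- by move=> n x _; rewrite EFinM nnfun_muleindic_ge0.
under [RHS]eq_integral.
  move=> x _; rewrite fimfunE -fsumEFin// muleC ge0_mule_fsumr; last first.
    by move=> r; rewrite EFinM nnfun_muleindic_ge0.
  over.
rewrite [RHS]ge0_integral_fsum//; last 2 first.
- move=> r; apply: emeasurable_funM; first exact/measurable_EFinP.
  exact/measurable_EFinP/measurableT_comp.
- by move=> n x _; rewrite EFinM mule_ge0 ?nnfun_muleindic_ge0// lee_fin.
apply: eq_fsbigr => r /[!inE] -[x _ <-].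
under [LHS]eq_integral do rewrite EFinM.
under [RHS]eq_integral do rewrite EFinM muleCA.
have fx0 : 0 <= (f x)%:E by rewrite lee_fin.
rewrite ge0_integralZl//; last exact/measurable_EFinP.
rewrite ge0_integralZl//; last 2 first.
- by apply: emeasurable_funM; apply/measurable_EFinP.
- by move=> y _; rewrite mule_ge0 ?lee_fin.
congr (_ * _); rewrite integral_indic// setIT nuE// integral_mkcond.
apply: eq_integral => y _; rewrite patchE indicE.
by case: ifPn; rewrite ?mule1 ?mule0.
Qed.

Lemma ge0_integral_density (f : T -> \bar R) :
  measurable_fun setT f -> (forall x, 0 <= f x) ->
  \int[nu]_x f x = \int[mu]_x (f x * (p x)%:E).
Proof.
move=> mf f0; pose f_ := nnsfun_approx measurableT mf.
have f_f x : (f_ n x)%:E @[n --> \oo] --> f x by exact: cvg_nnsfun_approx.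
have ndf_ x : {homo (fun n => (f_ n x)%:E) : m n / (m <= n)%N >-> m <= n}.
  by move=> m n mn; rewrite lee_fin; exact/lefP/nd_nnsfun_approx.
transitivity (limn (fun n => \int[nu]_x (f_ n x)%:E)).
  rewrite -monotone_convergence//.
  - by apply: eq_integral => x _; apply/esym/cvg_lim.
  - by move=> n; exact/measurable_EFinP.
  - by move=> n x _; rewrite lee_fin.
under eq_fun do rewrite integral_density_nnsfun.
rewrite -monotone_convergence//.
- by apply: eq_integral => x _; apply/cvg_lim => //; apply: cvgeZr.
- by move=> n; apply: emeasurable_funM; exact/measurable_EFinP.
- by move=> n x _; rewrite mule_ge0 ?lee_fin.
- by move=> x _ m n mn; rewrite lee_wpmul2r ?lee_fin//; exact: ndf_.
Qed.

End density.

Section gaussian1.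
Local Open Scope ereal_scope.
Context {R : realType}.
Local Notation leb := (@lebesgue_measure R).
Local Notation N1 := (normal_prob (0 : R) 1).
Local Notation L := (measurableTypeR R).
Implicit Types (f : R -> \bar R).

Lemma lebesgue_measure_translation h (B : set R) : measurable B ->
  pushforward leb ((fun x => x + h)%R : _ -> L) B = leb B.
Proof.
have mh : measurable_fun setT ((fun x => x + h)%R : L -> L).
  by exact: measurable_funD.
pose h' : {mfun L >-> L} :=
  HB.pack (fun x => x + h)%R (isMeasurableFun.Build _ _ _ _ _ mh).
move=> mB; apply/esym.
apply: (@lebesgue_measure_unique R (pushforward leb h')) => // _ [[a b]] _ <-.
transitivity (leb `](a - h)%R, (b - h)%R]%classic).
  by rewrite !lebesgue_measure_itv/= !lte_fin ltrD2r -!EFinB opprB addrA subrK.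
rewrite /pushforward/=; congr (leb _).
by apply/seteqP; split => x /=; rewrite !in_itv/= ltrBlDr lerBrDr.
Qed.

Lemma ge0_integral_translation h f : measurable_fun setT f ->
  (forall x, 0 <= f x) -> \int[leb]_x f (x + h)%R = \int[leb]_x f x.
Proof.
move=> mf f0.
have mh : measurable_fun setT ((fun x => x + h)%R : L -> L).
  by exact: measurable_funD.
transitivity (\int[pushforward leb ((fun x => x + h)%R : L -> L)]_x f x).
  by rewrite ge0_integral_pushforward.
by apply: eq_measure_integral => B mB _; exact: lebesgue_measure_translation.
Qed.

Lemma ge0_integral_reflection f : measurable_fun setT f ->
  (forall x, 0 <= f x) -> \int[leb]_x f (- x)%R = \int[leb]_x f x.
Proof.
move=> mf f0.
transitivity (\int[pushforward leb (-%R : L -> L)]_x f x).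
  by rewrite ge0_integral_pushforward.
by apply: eq_measure_integral => B mB _; exact: lebesgue_measureN.
Qed.

Lemma ge0_integral_normal f : measurable_fun setT f -> (forall x, 0 <= f x) ->
  \int[N1]_x f x = \int[leb]_x (f x * (normal_pdf 0 1 x)%:E).
Proof.
move=> mf f0; apply: (@ge0_integral_density _ _ _ leb N1) => //.
- by move=> x; exact: normal_pdf_ge0.
- exact: measurable_normal_pdf.
Qed.

Lemma normal_pdf01E x : normal_pdf 0 1 x =
  ((Num.sqrt (pi *+ 2))^-1 * expR (- (x ^+ 2) / 2) :> R)%R.
Proof.
by rewrite normal_pdfE// /normal_peak /normal_fun expr1n mul1r subr0.
Qed.

(** The Cameron-Martin formula in dimension one: translate the Lebesgue measure
    and complete the square in the exponent of the density. *)
Lemma ge0_integral_normal_shift h f : measurable_fun setT f ->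
  (forall x, 0 <= f x) ->
  \int[N1]_x f (x + h)%R = \int[N1]_x (f x * (expR (h * x - h ^+ 2 / 2))%:E).
Proof.
move=> mf f0.
have mh : measurable_fun setT (fun x : R => x + h)%R by exact: measurable_funD.
have mpdf : measurable_fun setT (EFin \o normal_pdf (0:R) 1).
  by apply/measurable_EFinP; exact: measurable_normal_pdf.
have mexp : measurable_fun setT (EFin \o (fun x => expR (h * x - h ^+ 2 / 2))).
  apply/measurable_EFinP; apply: measurableT_comp => //.
  by apply: measurable_funB => //; exact: measurable_funM.
rewrite ge0_integral_normal//; last exact: measurableT_comp.
rewrite ge0_integral_normal//; last 2 first.
- exact: emeasurable_funM.
- by move=> x; rewrite mule_ge0// lee_fin expR_ge0.
pose g x := f x * (expR (h * x - h ^+ 2 / 2))%:E * (normal_pdf 0 1 x)%:E.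
have mg : measurable_fun setT g.
  by apply: emeasurable_funM => //; exact: emeasurable_funM.
have g0 x : 0 <= g x by rewrite !mule_ge0// lee_fin ?expR_ge0 ?normal_pdf_ge0.
rewrite -[RHS](ge0_integral_translation h mg g0).
apply: eq_integral => x _; rewrite /g -muleA -EFinM; congr (_ * _%:E).
rewrite !normal_pdf01E mulrCA -expRD; congr (_ * expR _)%R.
by field.
Qed.

Lemma ge0_integral_normalN f : measurable_fun setT f ->
  (forall x, 0 <= f x) -> \int[N1]_x f (- x)%R = \int[N1]_x f x.
Proof.
move=> mf f0.
rewrite ge0_integral_normal//; last exact: measurableT_comp.
rewrite ge0_integral_normal//.
have mg : measurable_fun setT (fun x => f x * (normal_pdf 0 1 x)%:E).
  apply: emeasurable_funM => //; apply/measurable_EFinP.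
  exact: measurable_normal_pdf.
have g0 x : 0 <= f x * (normal_pdf 0 1 x)%:E.
  by rewrite mule_ge0// lee_fin normal_pdf_ge0.
rewrite -(ge0_integral_reflection mg g0).
by apply: eq_integral => x _; rewrite !normal_pdf01E sqrrN.
Qed.

(** This is the Cameron-Martin formula for the constant function 1. *)
Lemma normal_exp_moment (c : R) :
  \int[N1]_x (expR (c * x))%:E = (expR (c ^+ 2 / 2))%:E.
Proof.
have mexp : measurable_fun setT (EFin \o (fun x : R => expR (c * x - c ^+ 2 / 2))).
  apply/measurable_EFinP; apply: measurableT_comp => //.
  by apply: measurable_funB => //; exact: measurable_funM.
have := @ge0_integral_normal_shift c (cst 1) (measurable_cst _) (fun=> lee01).
rewrite integral_cst// mul1e /= probability_setT.
under [X in _ = X -> _]eq_integral do rewrite mul1e.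
move=> H; under eq_integral do
  rewrite -(subrK (c ^+ 2 / 2)%R (c * _)%R) addrC expRD EFinM.
by rewrite ge0_integralZl// -H mule1.
Qed.

Lemma normal_exp_norm_lty (c : R) : \int[N1]_x (expR (c * `|x|))%:E < +oo.
Proof.
apply: (@le_lt_trans _ _ (\int[N1]_x ((expR (c * x))%:E + (expR (- c * x))%:E))).
  have m c' : measurable_fun setT (EFin \o (fun x : R => expR (c' * x))).
    by apply/measurable_EFinP; apply: measurableT_comp => //; exact: measurable_funM.
  apply: ge0_le_integral => //.
  - apply/measurable_EFinP; apply: measurableT_comp => //.
    by apply: measurable_funM => //; exact: measurableT_comp.
  - by apply: emeasurable_funD; exact: m.
  - move=> x _; rewrite -EFinD lee_fin; case: (ger0P x) => _.
      by rewrite lerDl expR_ge0.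
    by rewrite mulrN mulNr lerDr expR_ge0.
rewrite ge0_integralD//; last 2 first.
- by apply/measurable_EFinP; apply: measurableT_comp => //; exact: measurable_funM.
- by apply/measurable_EFinP; apply: measurableT_comp => //; exact: measurable_funM.
by rewrite !normal_exp_moment -EFinD ltry.
Qed.

End gaussian1.

(** * The standard Gaussian vector *)

Section iid.
Local Open Scope ereal_scope.
Context {disp} {T : measurableType disp} {R : realType} (Q : probability T R).

Lemma measurable_cons_pair n : measurable_fun setT (@cons_pair _ T n).
Proof. exact: measurable_cons. Qed.

Lemma measurable_cons_tuple n (F : n.+1.-tuple T -> \bar R) x :
  measurable_fun setT F -> measurable_fun setT (fun t => F (cons_pair (x, t))).
Proof.
move=> mF; apply: (measurableT_comp mF).
by apply: (measurableT_comp (@measurable_cons_pair n)).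
Qed.

Lemma measurable_integral_cons n (F : n.+1.-tuple T -> \bar R) :
  measurable_fun setT F -> (forall t, 0 <= F t) ->
  measurable_fun setT (fun x => \int[iid_prob Q n]_t F (cons_pair (x, t))).
Proof.
move=> mF F0.
apply: (@measurable_fun_fubini_tonelli_F _ _ _ _ _ (iid_prob Q n)
  (F \o @cons_pair _ T n)) => [|x]; last exact: F0.
apply: (measurableT_comp mF); exact: measurable_cons_pair.
Qed.

Lemma ge0_integral_iidS n (F : n.+1.-tuple T -> \bar R) :
  measurable_fun setT F -> (forall t, 0 <= F t) ->
  \int[iid_prob Q n.+1]_t F t =
  \int[Q]_x \int[iid_prob Q n]_t F (cons_pair (x, t)).
Proof.
move=> mF F0; rewrite /= ge0_integral_distribution//.
rewrite fubini_tonelli1// => [|x]; last exact: F0.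
apply: (measurableT_comp mF); exact: measurable_cons_pair.
Qed.

Lemma tnth_cons_pair0 n x (t : n.-tuple T) : tnth (cons_pair (x, t)) ord0 = x.
Proof. by rewrite tnth0. Qed.

Lemma tnth_cons_pairS n x (t : n.-tuple T) j :
  tnth (cons_pair (x, t)) (lift ord0 j) = tnth t j.
Proof. by rewrite tnthS. Qed.

Lemma ge0_integral_iid_tnth n (i : 'I_n) (f : T -> \bar R) :
  measurable_fun setT f -> (forall x, 0 <= f x) ->
  \int[iid_prob Q n]_t f (tnth t i) = \int[Q]_x f x.
Proof.
move=> mf f0; elim: n i => [[]//|n IH] i.
rewrite ge0_integral_iidS//; last first.
  by apply: measurableT_comp => //; exact: measurable_tnth.
case: (unliftP ord0 i) => [j|] ->.
- under eq_integral do under eq_integral do rewrite tnth_cons_pairS.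
  transitivity (\int[Q]_x cst (\int[Q]_y f y) x).
    by apply: eq_integral => x _; rewrite IH.
  by rewrite (integral_cst _ measurableT) [X in _ * X]probability_setT mule1.
- under eq_integral do under eq_integral do rewrite tnth_cons_pair0.
  apply: eq_integral => x _.
  transitivity (\int[iid_prob Q n]_t cst (f x) t) => //.
  by rewrite (integral_cst _ measurableT) [X in _ * X]probability_setT mule1.
Qed.

End iid.

Section gaussian_vector.
Local Open Scope ereal_scope.
Context {R : realType}.
Local Notation N1 := (normal_prob (0 : R) 1).
Local Notation Nd d := (std_normal_vec R d).

Definition shift_coord d (i : 'I_d) (h : R) (t : d.-tuple R) : d.-tuple R :=
  [tuple (tnth t j + h *+ (j == i))%R | j < d].

Lemma measurable_shift d (i : 'I_d) h : measurable_fun setT (shift_coord i h).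
Proof.
apply/measurable_fun_tnthP => j /=.
rewrite (_ : _ \o _ = fun t => tnth t j + h *+ (j == i))%R; last first.
  by apply/funext => t /=; rewrite tnth_mktuple.
by apply: measurable_funD => //; exact: measurable_tnth.
Qed.

Lemma shift_cons0 d h x (t : d.-tuple R) :
  shift_coord ord0 h (cons_pair (x, t)) = cons_pair ((x + h)%R, t).
Proof.
apply: eq_from_tnth => j; rewrite tnth_mktuple.
case: (unliftP ord0 j) => [k|] ->; first by rewrite !tnth_cons_pairS addr0.
by rewrite !tnth_cons_pair0 eqxx.
Qed.

Lemma shift_consS d (i : 'I_d) h x (t : d.-tuple R) :
  shift_coord (lift ord0 i) h (cons_pair (x, t)) = cons_pair (x, shift_coord i h t).
Proof.
apply: eq_from_tnth => j; rewrite tnth_mktuple.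
case: (unliftP ord0 j) => [k|] ->; last by rewrite !tnth_cons_pair0 addr0.
by rewrite !tnth_cons_pairS tnth_mktuple (inj_eq (@lift_inj _ _)).
Qed.

(** The density of the Gaussian translated by [h] along the [i]-th axis with
    respect to the centred one. *)
Definition tilt d (i : 'I_d) (h : R) (t : d.-tuple R) : R :=
  expR (h * tnth t i - h ^+ 2 / 2).

Lemma measurable_tilt d (i : 'I_d) h : measurable_fun setT (tilt i h).
Proof.
apply: measurableT_comp => //; apply: measurable_funB => //.
by apply: measurable_funM => //; exact: measurable_tnth.
Qed.

(** The Cameron-Martin formula along a coordinate axis, by splitting off the
    first coordinate: either it is the translated one, or it is a parameter. *)
Lemma ge0_integral_shift d (i : 'I_d) h (F : d.-tuple R -> \bar R) :
  measurable_fun setT F -> (forall t, 0 <= F t) ->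
  \int[Nd d]_t F (shift_coord i h t) = \int[Nd d]_t (F t * (tilt i h t)%:E).
Proof.
elim: d i F => [[]//|d IH] i F mF F0.
have mtilt n j : measurable_fun setT (EFin \o @tilt n j h).
  by apply/measurable_EFinP; exact: measurable_tilt.
have tilt0 n j (t : n.-tuple R) : 0 <= (tilt j h t)%:E by rewrite lee_fin expR_ge0.
rewrite ge0_integral_iidS//; last exact: (measurableT_comp mF (@measurable_shift _ _ _)).
have mFt : measurable_fun setT (fun t => F t * (tilt i h t)%:E).
  by apply: emeasurable_funM => //; exact: mtilt.
have Ft0 t : 0 <= F t * (tilt i h t)%:E by rewrite mule_ge0.
rewrite [RHS]ge0_integral_iidS; [|exact: mFt|exact: Ft0].
case: (unliftP ord0 i) => [j|] ->.
  apply: eq_integral => x _.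
  under eq_integral do rewrite shift_consS.
  have mFx := measurable_cons_tuple x mF.
  rewrite (IH j _ mFx (fun t => F0 _)).
  by apply: eq_integral => t _; rewrite /tilt tnth_cons_pairS.
under eq_integral do under eq_integral do rewrite shift_cons0.
rewrite (@ge0_integral_normal_shift _ h
   (fun x => \int[Nd d]_t F (cons_pair (x, t))))//; last 2 first.
- exact: (@measurable_integral_cons _ _ _ N1 d F mF F0).
- by move=> x; apply: integral_ge0.
apply: eq_integral => x _; rewrite -ge0_integralZr//.
exact: measurable_cons_tuple.
Qed.

Definition norm1 d (t : d.-tuple R) : R := \sum_j `|tnth t j|.

Lemma norm1_cons d x (t : d.-tuple R) :
  norm1 (cons_pair (x, t)) = (`|x| + norm1 t)%R.
Proof.
rewrite /norm1 big_ord_recl tnth_cons_pair0; congr (_ + _)%R.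
by apply: eq_bigr => j _; rewrite tnth_cons_pairS.
Qed.

Lemma norm1_ge0 d (t : d.-tuple R) : (0 <= norm1 t)%R.
Proof. exact: sumr_ge0. Qed.

Lemma tnth_le_norm1 d (t : d.-tuple R) j : (`|tnth t j| <= norm1 t)%R.
Proof. by rewrite /norm1 (bigD1 j)//= lerDl sumr_ge0. Qed.

Lemma norm1_shift d i h (t : d.-tuple R) :
  (norm1 (shift_coord i h t) <= norm1 t + `|h|)%R.
Proof.
rewrite /norm1 (bigD1 i)//= [X in (_ <= X + _)%R](bigD1 i)//= addrAC.
apply: lerD; first by rewrite tnth_mktuple eqxx ler_normD.
by apply: ler_sum => j ji; rewrite tnth_mktuple (negbTE ji) addr0.
Qed.

Lemma measurable_norm1 d : measurable_fun setT (@norm1 d).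
Proof.
apply: measurable_sum => j; apply: measurableT_comp => //.
exact: measurable_tnth.
Qed.

Lemma measurable_exp_norm1 d (c : R) :
  measurable_fun setT (fun t : d.-tuple R => expR (c * norm1 t)).
Proof.
apply: measurableT_comp => //; apply: measurable_funM => //.
exact: measurable_norm1.
Qed.

(** The coordinates are independent, so the moment is a product of
    one-dimensional ones; the sum norm is chosen to make it factor. *)
Lemma exp_norm1_lty d (c : R) : \int[Nd d]_t (expR (c * norm1 t))%:E < +oo.
Proof.
elim: d => [|d IH].
  rewrite (eq_integral (cst 1)); last first.
    by move=> t _; rewrite /norm1 big_ord0 mulr0 expR0.
  by rewrite (integral_cst _ measurableT) [X in _ * X]probability_setT mule1 ltry.
have mE n : measurable_fun setT (fun t : n.-tuple R => (expR (c * norm1 t))%:E).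
  by apply/measurable_EFinP; exact: measurable_exp_norm1.
rewrite ge0_integral_iidS//; last exact: mE.
have cE x : \int[Nd d]_t (expR (c * norm1 (cons_pair (x, t))))%:E =
    (expR (c * `|x|))%:E * \int[Nd d]_t (expR (c * norm1 t))%:E.
  rewrite -ge0_integralZl//; last exact: mE.
  by apply: eq_integral => t _; rewrite norm1_cons mulrDr expRD EFinM.
under eq_integral do rewrite cE.
have I0 : 0 <= \int[Nd d]_t (expR (c * norm1 t))%:E.
  by apply: integral_ge0 => t _; rewrite lee_fin expR_ge0.
rewrite ge0_integralZr//; last first.
  apply/measurable_EFinP; apply: measurableT_comp => //.
  by apply: measurable_funM => //; exact: measurableT_comp.
rewrite lte_mul_pinfty//.
- by apply: integral_ge0 => t _; rewrite lee_fin expR_ge0.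
- rewrite ge0_fin_numE ?normal_exp_norm_lty//.
  by apply: integral_ge0 => t _; rewrite lee_fin expR_ge0.
Qed.

End gaussian_vector.

(** * Gaussian integration by parts in difference form *)

Section stein.
Context {R : realType}.
Local Notation Nd d := (std_normal_vec R d).

Lemma norm_expR_sub1_le (y : R) : `|expR y - 1| <= `|y| * expR `|y|.
Proof.
have h1 : 1 + y <= expR y by exact: expR_ge1Dx.
have h2 : expR y - 1 <= y * expR y.
  have := expR_ge1Dx (- y); rewrite -(ler_pM2r (expR_gt0 y)).
  by rewrite -expRD addNr expR0; lra.
have h3 : y * expR y <= `|y| * expR `|y|.
  apply: (@le_trans _ _ (`|y| * expR y)).
    by rewrite ler_pM2r ?expR_gt0 ?ler_norm.
  by rewrite ler_wpM2l// ler_expR ler_norm.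
have h4 : `|y| <= `|y| * expR `|y| by rewrite ler_peMr// -expR0 ler_expR.
rewrite ler_norml; apply/andP; split; last exact: le_trans h3.
have : - y <= `|y| by rewrite -normrN ler_norm.
lra.
Qed.

(** A bound linear in [h] makes the difference quotients of the tilt uniformly
    dominated, by a function with all the integrability needed. *)
Lemma tilt_diff_le d (i : 'I_d) (h : R) (t : d.-tuple R) : 0 < h <= 1 ->
  `|tilt i h t - 1| <= h * expR (1 + 2 * norm1 t).
Proof.
move=> /andP[h0 h1]; apply: le_trans (norm_expR_sub1_le _) _.
set x := tnth t i; set y := (X in `|X|).
have yx : `|y| <= h * (`|x| + 1).
  apply: le_trans (ler_normB _ _) _.
  rewrite normrM (gtr0_norm h0) (ger0_norm (divr_ge0 (sqr_ge0 h) (ler0n _ 2))).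
  have : h * h <= h * 1 by rewrite ler_pM2l.
  rewrite mulrDr lerD2l mulr1 expr2; lra.
have x1 : `|x| + 1 <= expR `|x| by rewrite addrC expR_ge1Dx.
have yx1 : `|y| <= `|x| + 1.
  by apply: le_trans yx _; rewrite ler_piMl// addr_ge0.
apply: (@le_trans _ _ (h * expR `|x| * expR (`|x| + 1))).
  apply: ler_pM => //; last by rewrite ler_expR.
  by apply: le_trans yx _; rewrite ler_pM2l.
rewrite -mulrA -expRD ler_pM2l// ler_expR.
have := tnth_le_norm1 t i; rewrite -/x; lra.
Qed.

Lemma cvg_tilt_diff d (i : 'I_d) (t : d.-tuple R) :
  n.+1%:R * (tilt i n.+1%:R^-1 t - 1) @[n --> \oo] --> tnth t i.
Proof.
set x := tnth t i.
pose y n : R := n.+1%:R^-1 * x - n.+1%:R^-1 ^+ 2 / 2.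
have n0 n : (0 : R) < n.+1%:R by rewrite ltr0n.
have yE n : n.+1%:R * y n = x - n.+1%:R^-1 / 2.
  by rewrite /y; field; rewrite gt_eqF.
have h0 : n.+1%:R^-1 @[n --> \oo] --> (0 : R) by exact: cvg_harmonic.
have hx : x - n.+1%:R^-1 / 2 @[n --> \oo] --> x.
  rewrite -[X in _ --> X]subr0 -(mul0r 2^-1).
  by apply: cvgB; [exact: cvg_cst|apply: cvgMl].
have y0 : y n @[n --> \oo] --> (0 : R).
  rewrite (_ : y = fun n => n.+1%:R^-1 * (x - n.+1%:R^-1 / 2)); last first.
    by apply/funext => n; rewrite -yE mulKf// gt_eqF.
  by rewrite -(mul0r x); apply: cvgM.
have ey : expR (y n) @[n --> \oo] --> (1 : R).
  rewrite -expR0; exact: (cvg_comp _ _ y0 (@continuous_expR R 0)).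
apply: (@squeeze_cvgr _ _ _ _ (fun n => x - n.+1%:R^-1 / 2)
  (fun n => (x - n.+1%:R^-1 / 2) * expR (y n))) => //; last first.
  by rewrite -[X in _ --> X]mulr1; apply: cvgM.
apply: nearW => n; rewrite -yE -mulrA !ler_pM2l//.
have := expR_ge1Dx (y n); have := expR_ge1Dx (- y n).
rewrite -(ler_pM2r (expR_gt0 (y n))) -expRD addNr expR0 /tilt -/x -/(y n).
by move=> ? ?; apply/andP; split; lra.
Qed.

Lemma integrable_exp_norm1 d (a c : R) :
  (Nd d).-integrable setT (fun t => (a * expR (c * norm1 t))%:E).
Proof.
rewrite (_ : (fun _ => _) = fun t => (a%:E * (expR (c * norm1 t))%:E)%E)//.
apply: integrableZl => //; apply/integrableP; split.
  by apply/measurable_EFinP; exact: measurable_exp_norm1.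
under eq_integral do rewrite /= ger0_norm ?expR_ge0//.
exact: exp_norm1_lty.
Qed.

Lemma growth_integrable d (G : d.-tuple R -> R) (a c : R) :
  measurable_fun setT G -> (forall t, `|G t| <= a * expR (c * norm1 t)) ->
  (Nd d).-integrable setT (EFin \o G).
Proof.
move=> mG Ga; apply: le_integrable (integrable_exp_norm1 d a c) => //.
  exact/measurable_EFinP.
by move=> t _ /=; rewrite lee_fin (le_trans (Ga t))// ler_norm.
Qed.

Section growth.
Context {d : nat} (F : d.-tuple R -> R) (K : R).
Hypothesis mF : measurable_fun setT F.
Hypothesis FK : forall t, `|F t| <= K * expR (norm1 t).

Let K0 : 0 <= K.
Proof.
have := FK (nseq_tuple d 0); have := normr_ge0 (F (nseq_tuple d 0)).
by move=> /le_trans/[apply]; rewrite pmulr_lge0 ?expR_gt0.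
Qed.

Lemma integral_shift (i : 'I_d) (h : R) :
  (\int[Nd d]_t (F (shift_coord i h t))%:E =
   \int[Nd d]_t (F t * tilt i h t)%:E)%E.
Proof.
have mEF : measurable_fun setT (EFin \o F) by exact/measurable_EFinP.
rewrite integralE [RHS]integralE; congr (_ - _)%E.
- transitivity (\int[Nd d]_t ((EFin \o F)^\+ (shift_coord i h t)))%E.
    by apply: eq_integral => t _; rewrite !funeposE.
  rewrite ge0_integral_shift//; last exact: measurable_funepos.
  apply: eq_integral => t _; rewrite !funeposE/= -!EFin_max -EFinM.
  by rewrite /tilt maxr_pMl ?expR_ge0// mul0r.
- transitivity (\int[Nd d]_t ((EFin \o F)^\- (shift_coord i h t)))%E.
    by apply: eq_integral => t _; rewrite !funenegE.
  rewrite ge0_integral_shift//; last exact: measurable_funeneg.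
  apply: eq_integral => t _; rewrite !funenegE/= -!EFin_max -EFinM.
  by rewrite /tilt maxr_pMl ?expR_ge0// mul0r mulNr.
Qed.

(** Tilting the Gaussian turns the difference quotient of [F] into [F] times
    the difference quotient of the tilt, whose limit is the coordinate; the
    exponential growth bound supplies the dominating function. *)
Lemma stein_difference (i : 'I_d) :
  (\int[Nd d]_t (n.+1%:R * (F (shift_coord i n.+1%:R^-1 t) - F t))%:E @[n --> \oo]
   --> \int[Nd d]_t (F t * tnth t i)%:E)%E.
Proof.
have mtilt h := @measurable_tilt R d i h.
have h01 n : 0 < (n.+1%:R^-1 : R) <= 1.
  by rewrite invr_gt0 ltr0n invf_le1 ?ler1n ?ltr0n.
have iF : (Nd d).-integrable setT (EFin \o F).
  by apply: (growth_integrable (a := K) (c := 1)) => // t; rewrite mul1r.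
have iFs n : (Nd d).-integrable setT (fun t => (F (shift_coord i n.+1%:R^-1 t))%:E).
  apply: (growth_integrable (G := F \o shift_coord i n.+1%:R^-1) (a := K * expR 1) (c := 1)).
    exact: (measurableT_comp mF (@measurable_shift _ _ _ _)).
  move=> t; apply: le_trans (FK _) _; rewrite -mulrA -expRD ler_wpM2l// ler_expR.
  apply: le_trans (norm1_shift _ _ _) _; rewrite addrC mul1r lerD2r.
  by case/andP: (h01 n) => h0 h1; rewrite gtr0_norm.
pose g (t : d.-tuple R) : \bar R := (K * expR 1 * expR (3 * norm1 t))%:E.
have bnd n t : `|F t * (n.+1%:R * (tilt i n.+1%:R^-1 t - 1))| <=
    K * expR 1 * expR (3 * norm1 t).
  rewrite normrM normrM (ger0_norm (ler0n _ _)).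
  have : n.+1%:R * `|tilt i n.+1%:R^-1 t - 1| <= expR (1 + 2 * norm1 t).
    by rewrite -ler_pdivlMl ?ltr0n// tilt_diff_le.
  move=> /(ler_pM (normr_ge0 _) (mulr_ge0 (ler0n _ _) (normr_ge0 _)) (FK t)).
  move=> /le_trans; apply; rewrite -!mulrA -!expRD.
  by rewrite ler_wpM2l// ler_expR; lra.
have intE n : (\int[Nd d]_t (n.+1%:R * (F (shift_coord i n.+1%:R^-1 t) - F t))%:E =
    \int[Nd d]_t (F t * (n.+1%:R * (tilt i n.+1%:R^-1 t - 1)))%:E)%E.
  have iFt : (Nd d).-integrable setT (fun t => (F t * tilt i n.+1%:R^-1 t)%:E).
    rewrite (_ : (fun _ => _) = fun t => (n.+1%:R^-1%:E *
      (F t * (n.+1%:R * (tilt i n.+1%:R^-1 t - 1)))%:E + (F t)%:E)%E); last first.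
      apply/funext => t; rewrite -EFinM -EFinD; congr EFin.
      by field; rewrite gt_eqF ?ltr0n.
    apply: integrableD => //; apply: integrableZl => //.
    apply: (growth_integrable (a := K * expR 1) (c := 3)) => //.
    apply: measurable_funM => //; apply: measurable_funM => //.
    by apply: measurable_funB => //; exact: mtilt.
  under eq_integral do rewrite EFinM EFinB.
  rewrite integralZl//; last exact: integrableB.
  rewrite integralB// integral_shift -integralB//.
  rewrite -integralZl//; last exact: integrableB.
  apply: eq_integral => t _; rewrite -EFinB -EFinM; congr EFin; ring.
under eq_fun do rewrite intE.
pose f n t : \bar R := (F t * (n.+1%:R * (tilt i n.+1%:R^-1 t - 1)))%:E.
have mf n : measurable_fun setT (f n).
  apply/measurable_EFinP; apply: measurable_funM => //.
  apply: measurable_funM => //.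
  by apply: measurable_funB => //; exact: mtilt.
have cf t : setT t -> f n t @[n --> \oo] --> (F t * tnth t i)%:E.
  move=> _; apply: cvg_EFin; first exact: nearW.
  by apply: cvgMr; exact: cvg_tilt_diff.
have gfin t : setT t -> g t \is a fin_num by [].
have ig : (Nd d).-integrable setT g by exact: integrable_exp_norm1.
have fg n t : setT t -> (`|f n t| <= g t)%E by rewrite lee_fin.
exact: (@dominated_cvg _ _ _ (Nd d) setT measurableT f _ g mf cf gfin ig fg).
Qed.

End growth.

End stein.

(** * The statistical dimension is at most the mean squared projection *)

Section measurable_row.
Context {R : realType} {d : nat}.

(** A continuous function is the pointwise limit of its values at the points of
    the grids of mesh [1/(n+1)], and each of these has countable range. *)
Lemma measurable_continuous_row (f : 'rV[R]_d -> R) : continuous f ->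
  measurable_fun setT (fun t : d.-tuple R => f (row_of_tuple t)).
Proof.
move=> cf; pose r n (t : d.-tuple R) : 'rV[R]_d :=
  \row_i ((Num.floor (n.+1%:R * tnth t i))%:~R / n.+1%:R).
apply: (@measurable_fun_cvg _ _ _ _ (fun n t => f (r n t))) => [n|t _].
  move=> _ B mB; rewrite setTI.
  pose g (z : {ffun 'I_d -> int}) : 'rV[R]_d := \row_i ((z i)%:~R / n.+1%:R).
  rewrite [X in measurable X](_ : _ = \bigcup_(z in setT)
      ([set _ | B (f (g z))] `&` \bigcap_(i in setT)
       [set t : d.-tuple R | Num.floor (n.+1%:R * tnth t i) = z i])); last first.
    apply/seteqP; split => [t Bt|t [z _ [Bz tz]]].
      exists [ffun i => Num.floor (n.+1%:R * tnth t i)] => //; split.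
        rewrite /= (_ : g _ = r n t)//.
        by apply/rowP => i; rewrite !mxE ffunE.
      by move=> i _; rewrite /= ffunE.
    rewrite /= (_ : r n t = g z)//.
    by apply/rowP => i; rewrite !mxE tz.
  apply: countable_bigcupT_measurable => [|z]; first exact: countableP.
  apply: measurableI.
    have [Bz|Bz] := pselect (B (f (g z))).
      by rewrite (_ : [set _ | _] = setT)//; apply/seteqP; split.
    by rewrite (_ : [set _ | _] = set0)//; apply/seteqP; split.
  apply: fin_bigcap_measurable => [|i _]; first exact: finite_finset.
  rewrite [X in measurable X](_ : _ =
    (fun t : d.-tuple R => n.+1%:R * tnth t i) @^-1` `[(z i)%:~R, (z i + 1)%:~R[%classic).
    rewrite -[X in measurable X]setTI.
    have /(_ measurableT) : measurable_fun setT (fun t : d.-tuple R => n.+1%:R * tnth t i).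
      by apply: measurable_funM => //; exact: measurable_tnth.
    by apply; exact: measurable_itv.
  apply/seteqP; split => t /=; rewrite in_itv/=.
    by move=> <-; exact: floor_itv.
  exact: floor_def.
have rt : r n t @[n --> \oo] --> row_of_tuple t.
  apply/cvgrPdist_le => /= e e0; near=> n.
  rewrite [leLHS]/Num.norm/= mx_normrE; apply/bigmax_leP; split => /=; first exact: ltW.
  move=> [i j] _ /=; rewrite !mxE.
  have n0 : (0 : R) < n.+1%:R by rewrite ltr0n.
  have /andP[h1 h2] := floor_itv (n.+1%:R * tnth t j).
  apply: (@le_trans _ _ n.+1%:R^-1); last first.
    near: n; have := @cvg_harmonic R => /cvgrPdist_le/(_ e e0).
    apply: filterS => n; rewrite sub0r normrN.
    exact: le_trans (ler_norm _).
  rewrite -(ler_pM2l n0) mulfV ?gt_eqF// -[X in X * _](gtr0_norm n0) -normrM.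
  rewrite mulrBr mulrCA mulfV ?gt_eqF// mulr1 ger0_norm ?subr_ge0//.
  by rewrite ltW// ltrBlDl -(intrD _ _ 1).
exact: (cvg_comp _ _ rt (cf (row_of_tuple t))).
Unshelve. all: by end_near. Qed.

End measurable_row.

Lemma near_le_limn_einf {R : realType} (a : \bar R) (u : (\bar R)^nat) :
  (\forall n \near \oo, a <= u n)%E -> (a <= limn_einf u)%E.
Proof.
move=> [N _ Nu]; rewrite limn_einf_lim.
apply: lime_ge; first exact: is_cvg_einfs.
exists N => // n /= Nn; apply: le_ereal_inf_tmp => _ /= [k nk <-].
by apply: Nu => /=; exact: leq_trans nk.
Qed.

Section stat_dim_proj.
Context {R : realType} {d m : nat} (A : 'M[R]_(d, m)).
Local Notation C := (polycone A).
Local Notation proj := (euclid_proj C).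
Local Notation Nd := (std_normal_vec R d).
Local Notation projt t := (proj (row_of_tuple t)).
Local Notation face_dim t := (\dim (active A (projt t))).

Lemma measurable_proj i :
  measurable_fun setT (fun t : d.-tuple R => projt t 0 i).
Proof.
apply: (@measurable_continuous_row _ _ (fun x => proj x 0 i)) => x.
exact: (cvg_comp _ _ (@continuous_proj _ _ _ A x) (@coord_continuous _ _ _ 0 i _)).
Qed.

(** The active subspace depends only on the set of active constraints, which
    takes finitely many values. *)
Lemma measurable_face_dim (k : nat) : measurable [set t : d.-tuple R | face_dim t = k].
Proof.
have act_eq x y : (forall j, ((x *m A) 0 j == 0) = ((y *m A) 0 j == 0)) ->
    active A x = active A y.
  move=> xy; rewrite /active; congr (lker (linfun (mulmxr _))).
  by apply/matrixP => i j; rewrite mxE [RHS]mxE xy.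
pose pattern (x : 'rV[R]_d) : {set 'I_m} := [set j | (x *m A) 0 j == 0]%SET.
pose D := [set S | exists2 x, pattern x = S & \dim (active A x) = k].
rewrite (_ : [set _ | _] = \bigcup_(S in D) [set t : d.-tuple R | pattern (projt t) = S]).
  apply: fin_bigcup_measurable => [|S _]; first exact: finite_finset.
  rewrite (_ : [set _ | _] = \bigcap_(j in setT)
      [set t : d.-tuple R | ((projt t *m A) 0 j == 0) = (j \in S)]).
    apply: fin_bigcap_measurable => [|j _]; first exact: finite_finset.
    have mj : measurable_fun setT (fun t : d.-tuple R => (projt t *m A) 0 j).
      apply: (@measurable_continuous_row _ _ (fun x => (proj x *m A) 0 j)) => x.
      exact: (cvg_comp _ _ (@continuous_proj _ _ _ A x)
        (@continuous_mulmx_coord _ _ _ A j _)).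
    have m0 : measurable [set t : d.-tuple R | (projt t *m A) 0 j == 0].
      rewrite (_ : [set _ | _] = setT `&`
          (fun t : d.-tuple R => (projt t *m A) 0 j) @^-1` [set 0]).
        exact: mj.
      by rewrite setTI; apply/seteqP; split => t /= /eqP.
    have [jS|jS] := boolP (j \in S).
      by rewrite (_ : [set _ | _] = [set t : d.-tuple R | (projt t *m A) 0 j == 0]).
    rewrite (_ : [set _ | _] = ~` [set t : d.-tuple R | (projt t *m A) 0 j == 0]).
      exact: measurableC.
    by apply/seteqP; split => t /=; [move=> ->|move/negP/negbTE].
  apply/seteqP; split => [t <- j _|t tS]; first by rewrite /= inE.
  by apply/setP => j; rewrite inE; exact: tS.
apply/seteqP; split => [t tk|t [S [x xS xk] tS]].
  by exists (pattern (projt t)) => //; exists (projt t).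
rewrite /= -xk; congr (\dim _); apply: act_eq => j.
by have /setP/(_ j) := etrans tS (esym xS); rewrite !inE.
Qed.

Lemma face_dim_sum (t : d.-tuple R) : (face_dim t)%:R =
  \sum_(k < d.+1) k%:R * \1_[set t | face_dim t = k :> nat] t :> R.
Proof.
have dimd : (face_dim t < d.+1)%N.
  by rewrite ltnS (leq_trans (dimvS (subvf _)))// dimvf /dim /= mul1n.
rewrite (bigD1 (Ordinal dimd))//= indicE mem_set// mulr1 big1 ?addr0// => k kt.
rewrite indicE memNset ?mulr0//= => tk; move/eqP: kt; apply.
exact/val_inj.
Qed.

(** The events defining the intrinsic volumes are level sets of the dimension
    of the active subspace, hence measurable and disjoint. *)
Lemma stat_dimE :
  ((stat_dim C)%:E = \int[Nd]_t ((face_dim t)%:R)%:E)%E.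
Proof.
pose B k := [set t : d.-tuple R | face_dim t = k].
have mB k : measurable (B k : set (d.-tuple (measurableTypeR R))).
  exact: measurable_face_dim.
have nuE k : intrinsic_volume C k = fine (Nd (B k)).
  rewrite /intrinsic_volume; congr (fine (Nd _)).
  by apply/seteqP; split => t /=;
    rewrite (rel_interior_face_dim _ (proj_polycone A (row_of_tuple t))).
have E t : (face_dim t)%:R = \sum_(k < d.+1) k%:R * \1_(B k) t :> R.
  exact: face_dim_sum.
under eq_integral do rewrite E -sumEFin.
rewrite ge0_integral_sum//; last first.
  by move=> k; apply/measurable_EFinP; apply: measurable_funM.
rewrite /stat_dim -sumEFin; apply: eq_bigr => k _.
under eq_integral do rewrite EFinM.
rewrite ge0_integralZl//; last exact/measurable_EFinP.
by rewrite integral_indic// setIT nuE EFinM fineK// fin_num_measure.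
Qed.

Lemma row_of_shift_coord i h (t : d.-tuple R) :
  row_of_tuple (shift_coord i h t) = row_of_tuple t + h *: delta_mx 0 i.
Proof.
apply/rowP => j; rewrite !mxE eqxx/= tnth_mktuple eq_sym.
by case: eqP => _; rewrite ?mulr1n ?mulr0n ?mulr1 ?mulr0.
Qed.

Lemma norm_proj_le (t : d.-tuple R) i : `|projt t 0 i| <= norm1 t.
Proof.
apply: le_trans (normr_coord_le _ _) _.
rewrite -(ger0_norm (norm1_ge0 t)) -sqrtr_sqr ler_wsqrtr// -sqnorm2_dot.
have polar0 c : C c -> dot 0 c <= 0 by rewrite /dot mul0mx mxE.
apply: le_trans (sqnorm2_proj_le_dist_polar _ polar0) _.
rewrite subr0 /sqnorm2 expr2 {1}/norm1 mulr_suml; apply: ler_sum => j _.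
by rewrite mxE -real_normK ?num_real// expr2 ler_wpM2l// tnth_le_norm1.
Qed.

(** Each difference quotient below is nonnegative because projections are
    monotone, so Fatou's lemma applies to the sequence [h = 1/(n+1)]. *)
Lemma stat_dim_le_sqnorm2_proj :
  ((stat_dim C)%:E <= \int[Nd]_t (sqnorm2 (projt t))%:E)%E.
Proof.
have growth i (t : d.-tuple R) : `|projt t 0 i| <= 1 * expR (norm1 t).
  apply: le_trans (norm_proj_le t i) _; rewrite mul1r.
  by apply: le_trans (expR_ge1Dx _); rewrite lerDr.
pose q i n (t : d.-tuple R) : R :=
  n.+1%:R * (projt (shift_coord i n.+1%:R^-1 t) 0 i - projt t 0 i).
have q0 i n t : 0 <= q i n t.
  rewrite mulr_ge0//.
  have := proj_firm A (row_of_tuple (shift_coord i n.+1%:R^-1 t)) (row_of_tuple t).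
  rewrite row_of_shift_coord addrAC subrr add0r dotZl dotC -coord_dot sqnorm2_dot.
  move=> /(le_trans (dot_ge0 _)); rewrite pmulr_rge0 ?invr_gt0 ?ltr0n//.
  by rewrite mxE [X in _ + X]mxE.
have mq i n : measurable_fun setT (q i n).
  apply: measurable_funM => //; apply: measurable_funB; last exact: measurable_proj.
  apply: (measurableT_comp (f := fun t => projt t 0 i)); first exact: measurable_proj.
  exact: measurable_shift.
pose Q n (t : d.-tuple R) : \bar R := (\sum_i (q i n t)%:E)%E.
have Q0 n t : (0 <= Q n t)%E by apply: sume_ge0 => i _; rewrite lee_fin.
have mQ n : measurable_fun setT (Q n).
  by apply: emeasurable_sum => i; apply/measurable_EFinP; exact: mq.
have dimQ t : ((face_dim t)%:R%:E <= limn_einf (Q ^~ t))%E.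
  apply: near_le_limn_einf.
  have [e /= e0 eP] := proj_divergence A (row_of_tuple t).
  have := @cvg_harmonic R => /cvgrPdist_lt/(_ e e0).
  apply: filterS => n ne.
  have n0 : (0 : R) < n.+1%:R by rewrite ltr0n.
  have := eP n.+1%:R^-1 ne; rewrite invr_gt0 => /(_ n0).
  rewrite /Q sumEFin lee_fin ler_pdivrMl// => /le_trans; apply.
  rewrite mulr_sumr; apply: ler_sum => i _.
  by rewrite /q row_of_shift_coord.
have cQ : (\int[Nd]_t Q n t @[n --> \oo] -->
    \int[Nd]_t (sqnorm2 (projt t))%:E)%E.
  have mFt i : measurable_fun setT (fun t : d.-tuple R => projt t 0 i * tnth t i).
    by apply: measurable_funM; [exact: measurable_proj|exact: measurable_tnth].
  rewrite (_ : (\int[Nd]_t (sqnorm2 (projt t))%:E =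
      \sum_(i < d) \int[Nd]_t (projt t 0 i * tnth t i)%:E)%E); last first.
    rewrite -integral_sum// => [|i].
      apply: eq_integral => t _; rewrite sqnorm2_proj dotE sumEFin; congr EFin.
      by apply: eq_bigr => i _; rewrite mulrC mxE.
    apply: (growth_integrable (a := 1) (c := 2)) => // t.
    rewrite normrM mul1r mulr2n mulrDl mul1r expRD; apply: ler_pM => //.
      by rewrite (le_trans (growth i t))// mul1r.
    apply: le_trans (tnth_le_norm1 t i) _.
    by apply: le_trans (expR_ge1Dx _); rewrite lerDr.
  rewrite (_ : (fun _ => _) = fun n => (\sum_(i < d) \int[Nd]_t (q i n t)%:E)%E).
    apply: cvg_nnesum => i _.
      by apply: nearW => n; apply: integral_ge0 => t _; rewrite lee_fin.
    exact: (stein_difference (measurable_proj i) (growth i)).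
  apply/funext => n; rewrite /Q ge0_integral_sum// => i.
    by apply/measurable_EFinP; exact: mq.
  by move=> t _; rewrite lee_fin.
rewrite stat_dimE -(cvg_limn_einf_sup cQ).1.
apply: le_trans (fatou Nd measurableT mQ (fun n t _ => Q0 n t)).
apply: ge0_le_integral => //.
- apply/measurable_EFinP.
  have -> : (fun t : d.-tuple R => (face_dim t)%:R : R) = fun t =>
      \sum_(k < d.+1) k%:R * \1_[set t | face_dim t = k :> nat] t.
    by apply/funext => t; exact: face_dim_sum.
  apply: measurable_sum => k; apply: measurable_funM => //.
  by apply: measurable_indic; exact: measurable_face_dim.
- by apply: measurableT_comp => //; apply: measurable_fun_limn_esup => n;
    apply: measurableT_comp => //; exact: mQ.
Qed.

End stat_dim_proj.

(** * One-dimensional Gaussian moments *)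

Section moments.
Context {R : realType}.
Local Notation leb := (@lebesgue_measure R).
Local Notation N1 := (normal_prob (0 : R) 1).
Implicit Types (l x u : R).

Let measurable_sqr_EFin (f : R -> R) : measurable_fun setT f ->
  measurable_fun setT (fun x => (f x ^+ 2)%:E).
Proof. by move=> mf; apply/measurable_EFinP; exact: measurable_funX. Qed.

(** Integrating [x * x] by parts: the difference quotients of the coordinate
    function are all 1. *)
Lemma normal_second_moment : (\int[N1]_x (x ^+ 2)%:E = 1)%E.
Proof.
have gr (t : 1.-tuple R) : `|tnth t ord0| <= 1 * expR (norm1 t).
  rewrite mul1r; apply: le_trans (tnth_le_norm1 t ord0) _.
  by apply: le_trans (expR_ge1Dx _); rewrite lerDr.
have E n : (\int[std_normal_vec R 1]_t (n.+1%:R *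
    (tnth (shift_coord ord0 n.+1%:R^-1 t) ord0 - tnth t ord0))%:E = 1)%E.
  transitivity (\int[std_normal_vec R 1]_t cst 1%E t)%E.
    apply: eq_integral => t _.
    by rewrite tnth_mktuple eqxx mulr1n addrAC subrr add0r mulfV// pnatr_eq0.
  by rewrite (integral_cst _ measurableT) [X in (_ * X)%E]probability_setT mule1.
have := @stein_difference R 1 (fun t => tnth t ord0) 1
  (@measurable_tnth _ R 1 ord0) gr ord0.
under eq_fun do rewrite E.
move=> h.
have := cvg_lim (@ereal_hausdorff R) h; rewrite lim_cst//.
under eq_integral do rewrite -expr2.
rewrite (ge0_integral_iid_tnth N1 ord0 (f := fun x => (x ^+ 2)%:E))//; last 2 first.
- by apply/measurable_EFinP; apply: measurable_funX.
- by move=> x; rewrite lee_fin sqr_ge0.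
by move=> <-.
Qed.

(** By symmetry the integral is unchanged when [l] becomes [- l], and the
    average of the two integrands is [x ^ 2 + l ^ 2]. *)
Lemma normal_shifted_second_moment l :
  (\int[N1]_x ((x - l) ^+ 2)%:E = (1 + l ^+ 2)%:E)%E.
Proof.
have mB a : measurable_fun setT (fun x : R => x - a) by exact: measurable_funB.
have symm : (\int[N1]_x ((x + l) ^+ 2)%:E = \int[N1]_x ((x - l) ^+ 2)%:E)%E.
  rewrite -(ge0_integral_normalN (f := fun x => ((x - l) ^+ 2)%:E)).
  - by apply: eq_integral => x _; rewrite -opprD sqrrN.
  - exact: measurable_sqr_EFin.
  - by move=> x; rewrite lee_fin sqr_ge0.
have : (\int[N1]_x (((x - l) ^+ 2)%:E + ((x + l) ^+ 2)%:E) =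
        \int[N1]_x (2%:E * (x ^+ 2)%:E + cst (2 * l ^+ 2)%:E x))%E.
  by apply: eq_integral => x _; rewrite /= -!EFinD; congr EFin; ring.
have msq a : measurable_fun setT (fun x : R => ((x - a) ^+ 2)%:E) by exact: measurable_sqr_EFin.
have msq' : measurable_fun setT (fun x : R => ((x + l) ^+ 2)%:E).
  by apply: measurable_sqr_EFin; exact: measurable_funD.
have mx2 : measurable_fun setT (fun x : R => (x ^+ 2)%:E).
  by apply/measurable_EFinP; exact: measurable_funX.
have m2x2 := measurable_funeM 2%:E mx2.
have x20 x : (0 <= 2%:E * (x ^+ 2)%:E)%E by rewrite -EFinM lee_fin mulr_ge0 ?sqr_ge0.
rewrite ge0_integralD//; last 3 first.
- by move=> x _; rewrite lee_fin sqr_ge0.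
- exact: msq.
- by move=> x _; rewrite lee_fin sqr_ge0.
rewrite ge0_integralD//; last by move=> x _; rewrite lee_fin mulr_ge0// sqr_ge0.
rewrite symm ge0_integralZl//; last first.
  by move=> x _; rewrite lee_fin sqr_ge0.
rewrite normal_second_moment (integral_cst _ measurableT).
rewrite mule1 [X in (_ * X)%E]probability_setT mule1.
case: (\int[N1]_x _)%E => [r| |]//.
rewrite -!EFinD => -[rr]; congr EFin; lra.
Qed.

Definition truncated_moment (k : nat) l : R :=
  \int[leb]_(u in `[l, +oo[) ((u - l) ^+ k * expR (- (u ^+ 2) / 2)).

(** Dominates the integrands of order 1 and 2; it is integrable because the
    Gaussian has exponential moments. *)
Let dominating u : R := expR (2 * `|u|) * expR (- (u ^+ 2) / 2).

Let measurable_gauss : measurable_fun setT (fun u : R => expR (- (u ^+ 2) / 2)).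
Proof.
apply: measurableT_comp => //; apply: measurable_funM => //.
by apply: measurable_funN; exact: measurable_funX.
Qed.

Let integrable_dominating : leb.-integrable setT (EFin \o dominating).
Proof.
have md : measurable_fun setT (fun u : R => expR (2 * `|u|)).
  by apply: measurableT_comp => //; apply: measurable_funM => //; exact: measurableT_comp.
have c0 : 0 < Num.sqrt (pi *+ 2) :> R by rewrite sqrtr_gt0 mulrn_wgt0// pi_gt0.
apply/integrableP; split.
  by apply/measurable_EFinP; exact: measurable_funM.
have := @normal_exp_norm_lty R 2; rewrite ge0_integral_normal//; last first.
  exact/measurable_EFinP.
move=> h; apply: le_lt_trans (_ : (Num.sqrt (pi *+ 2))%:E * _ < +oo)%E; last first.
  apply: lte_mul_pinfty h; rewrite ?lee_fin ?ltW//.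
rewrite -ge0_integralZl//; last 2 first.
- apply: emeasurable_funM; first exact/measurable_EFinP.
  by apply/measurable_EFinP; exact: measurable_normal_pdf.
- by move=> x _; rewrite mule_ge0// lee_fin ?expR_ge0 ?normal_pdf_ge0.
rewrite le_eqVlt; apply/orP; left; apply/eqP; apply: eq_integral => x _.
rewrite /= ger0_norm ?mulr_ge0 ?expR_ge0// normal_pdf01E -!EFinM; congr EFin.
by rewrite /dominating; field; rewrite gt_eqF.
Qed.

Definition pos_moment_fun (k : nat) l u : R :=
  Num.max (u - l) 0 ^+ k * expR (- (u ^+ 2) / 2).

Lemma measurable_pos_part l : measurable_fun setT (fun u : R => Num.max (u - l) 0).
Proof. by apply: measurable_maxr => //; exact: measurable_funB. Qed.

Lemma integrable_pos_moment_fun k l : (0 < k <= 2)%N -> 0 <= l ->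
  leb.-integrable setT (EFin \o pos_moment_fun k l).
Proof.
move=> k2 l0; apply: le_integrable integrable_dominating => //.
  apply/measurable_EFinP; apply: measurable_funM => //.
  by apply: measurable_funX; exact: measurable_pos_part.
move=> u _ /=; rewrite lee_fin !ger0_norm ?mulr_ge0 ?exprn_ge0 ?expR_ge0//; last first.
  by rewrite le_max lexx orbT.
rewrite ler_wpM2r ?expR_ge0//.
have h0 : 0 <= Num.max (u - l) 0 by rewrite le_max lexx orbT.
have h1 : Num.max (u - l) 0 <= expR `|u|.
  rewrite ge_max expR_ge0 andbT; have := expR_ge1Dx `|u|; have := ler_norm u.
  lra.
have e1 : 1 <= expR `|u| by rewrite -expR0 ler_expR.
have -> : expR (2 * `|u|) = expR `|u| ^+ 2 by rewrite -expRM_natl mulr_natl.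
apply: le_trans (_ : expR `|u| ^+ k <= _); first by rewrite lerXn2r// nnegrE expR_ge0.
by apply: ler_weXn2l => //; case/andP: k2.
Qed.

Lemma truncated_momentE k l : (0 < k)%N ->
  truncated_moment k l = \int[leb]_u pos_moment_fun k l u.
Proof.
move=> k0; rewrite /truncated_moment Rintegral_mkcond; apply: eq_Rintegral => u _.
rewrite patchE mem_setE in_itv/= andbT /pos_moment_fun.
case: ifPn => [lu|]; first by rewrite max_l// subr_ge0.
by rewrite -ltNge => ul; rewrite max_r ?subr_le0 ?ltW// expr0n gtn_eqF// mul0r.
Qed.

(** Both tails of the symmetric density contribute equally. *)
Lemma normal_excess_moment l : 0 <= l ->
  (\int[N1]_x (Num.max (`|x| - l) 0 ^+ 2)%:E =
   (Num.sqrt (2 / pi) * truncated_moment 2 l)%:E)%E.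
Proof.
move=> l0.
have mp : measurable_fun setT (fun x : R => (Num.max (x - l) 0 ^+ 2)%:E).
  by apply: measurable_sqr_EFin; exact: measurable_pos_part.
have p0 x : (0 <= (Num.max (x - l) 0 ^+ 2)%:E)%E by rewrite lee_fin sqr_ge0.
transitivity (\int[N1]_x ((Num.max (x - l) 0 ^+ 2)%:E +
    (Num.max (- x - l) 0 ^+ 2)%:E))%E.
  apply: eq_integral => x _; rewrite -EFinD; congr EFin.
  have [x0|x0] := ger0P x.
    by rewrite [X in _ + X ^+ 2]max_r ?expr0n/= ?addr0//; lra.
  by rewrite [X in X ^+ 2 + _]max_r ?expr0n/= ?add0r//; lra.
rewrite ge0_integralD//; last by apply: (measurableT_comp mp).
rewrite (ge0_integral_normalN (f := fun x => (Num.max (x - l) 0 ^+ 2)%:E))//.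
rewrite ge0_integral_normal//.
have c0 : 0 < Num.sqrt (pi *+ 2) :> R by rewrite sqrtr_gt0 mulrn_wgt0// pi_gt0.
rewrite (_ : (\int[leb]_x _)%E =
    ((Num.sqrt (pi *+ 2))^-1%:E * (truncated_moment 2 l)%:E)%E); last first.
  have ip := @integrable_pos_moment_fun 2 l isT l0.
  rewrite truncated_momentE// fineK ?integrable_fin_num// -integralZl//.
  apply: eq_integral => x _; rewrite normal_pdf01E /pos_moment_fun/= -!EFinM.
  by rewrite mulrCA.
rewrite -!EFinM -EFinD -mulrDl; congr ((_ * _)%:E).
have -> : 2 / pi = (2 * (Num.sqrt (pi *+ 2))^-1) ^+ 2 :> R.
  have := pi_gt0 R; move: (pi : R) => p p_gt0.
  rewrite exprMn exprVn sqr_sqrtr ?mulrn_wge0 ?ltW// -[p *+ 2]mulr_natr.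
  by field; rewrite gt_eqF.
by rewrite sqrtr_sqr ger0_norm ?mulr_ge0 ?invr_ge0 ?ltW//; lra.
Qed.

Lemma sqr_pos_part_tangent u l l' :
  Num.max (u - l) 0 ^+ 2 - 2 * (l' - l) * Num.max (u - l) 0 <=
  Num.max (u - l') 0 ^+ 2.
Proof.
case: (lerP (u - l) 0) => ul; first by rewrite expr0n/= !mulr0 subr0 sqr_ge0.
case: (lerP (u - l') 0) => ul'.
  have h1 : 0 <= (u - l) * (l' - u) by rewrite mulr_ge0 ?(ltW ul)//; lra.
  have h2 : 0 <= (u - l) * (u - l) by rewrite mulr_ge0// ltW.
  by rewrite expr0n/= expr2; lra.
by have := sqr_ge0 (l' - l); rewrite !expr2; lra.
Qed.

(** Integrate the tangent line inequality of the convex function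
    [l |-> max(u - l, 0) ^ 2] over [u]. *)
Lemma truncated_moment_tangent l l' : 0 <= l -> 0 <= l' ->
  truncated_moment 2 l - 2 * (l' - l) * truncated_moment 1 l <=
  truncated_moment 2 l'.
Proof.
move=> l0 l'0; rewrite !truncated_momentE//.
have i2 := @integrable_pos_moment_fun 2 l isT l0.
have i2' := @integrable_pos_moment_fun 2 l' isT l'0.
have i1 := @integrable_pos_moment_fun 1 l isT l0.
have iz : leb.-integrable setT
    (EFin \o (fun u => 2 * (l' - l) * pos_moment_fun 1 l u)).
  rewrite (_ : _ \o _ = fun u => ((2 * (l' - l))%:E * (pos_moment_fun 1 l u)%:E)%E)//.
  exact: integrableZl.
rewrite -RintegralZl// -RintegralB//; apply: le_Rintegral => //.
  rewrite (_ : _ \o _ = fun u => ((pos_moment_fun 2 l u)%:E -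
    (2 * (l' - l) * pos_moment_fun 1 l u)%:E)%E)//.
  exact: integrableB.
move=> u _; rewrite /pos_moment_fun mulrA -mulrBl ler_wpM2r ?expR_ge0// expr1.
exact: sqr_pos_part_tangent.
Qed.

End moments.

(** * Descent cones of weighted l1 norms *)

Section descent.
Context {R : realType} {d : nat}.
Implicit Types (w x z c : 'rV[R]_d) (I : {set 'I_d}).

Local Notation sign j i := ((-1) ^+ (enum_val j : {ffun 'I_d -> bool}) i).

(** One column for each choice of signs outside [I]: the maximum of these
    linear forms is the directional derivative of the weighted norm. *)
Definition sign_mx I w : 'M[R]_(d, #|{ffun 'I_d -> bool}|) :=
  \matrix_(i, j) (w 0 i * (if i \in I then 1 else sign j i)).

Lemma mul_sign_mx I w z j : (z *m sign_mx I w) 0 j =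
  \sum_i w 0 i * (if i \in I then z 0 i else sign j i * z 0 i).
Proof.
rewrite mxE; apply: eq_bigr => i _; rewrite mxE.
by case: ifP => _; rewrite ?mulr1 mulrC// mulrA.
Qed.

(** The maximum over the signs is attained at those of [z]. *)
Lemma polycone_sign_mxP I w z : (forall i, 0 < w 0 i) ->
  polycone (sign_mx I w) z <->
  \sum_i w 0 i * (if i \in I then z 0 i else `|z 0 i|) <= 0.
Proof.
move=> w0; split => [Cz|Cz j]; last first.
  apply: le_trans Cz; rewrite mul_sign_mx; apply: ler_sum => i _.
  rewrite ler_pM2l//; case: ifP => // _.
  by apply: le_trans (ler_norm _) _; rewrite normrM normrX normrN1 expr1n mul1r.
(* The constraint whose signs agree with those of [z]. *)
have := Cz (enum_rank [ffun i : 'I_d => z 0 i < 0]); rewrite mul_sign_mx.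
congr (_ <= _); apply: eq_bigr => i _; rewrite enum_rankK ffunE.
by case: ifP => // _; congr (_ * _); case: (ltrgt0P (z 0 i)) => h;
  rewrite ?expr0 ?expr1 ?mul1r ?mulN1r.
Qed.

Lemma descent_coneI_polycone I w : (forall i, 0 < w 0 i) ->
  descent_coneI I w = polycone (sign_mx I w).
Proof.
move=> w0; apply/seteqP; split.
  move=> _ [n [t [s [t0 Ds ->]]]] j.
  rewrite mulmx_suml summxE -oppr_ge0 -sumrN; apply: sumr_ge0 => k _.
  rewrite -scalemxAl mxE -mulrN mulr_ge0// oppr_ge0.
  have [x /= xle <-] := Ds k; move: j.
  apply/(polycone_sign_mxP _ _ w0); move: xle; rewrite -subr_le0 /wnorm1 -sumrB.
  apply: le_trans; apply: ler_sum => i _; rewrite -mulrBr ler_pM2l// !mxE.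
  case: ifP => iI; rewrite ?iI /=; last by rewrite mulr0n subr0 normr0 subr0.
  by rewrite normr1 lerB// ler_norm.
move=> z /(polycone_sign_mxP _ _ w0) Cz.
(* The step [1/M] keeps every coordinate of the indicator vector of [I]
   nonnegative, so that the norm is linear along it. *)
pose M := 1 + \sum_i `|z 0 i|; have M0 : 0 < M by rewrite ltr_pwDl// sumr_ge0.
exists 1, (fun=> M), (fun=> M^-1 *: z); split => [_|_|]; first exact: ltW.
  exists ((\row_i (i \in I)%:R) + M^-1 *: z); last by rewrite addrC addKr.
  rewrite /= -subr_le0 /wnorm1 -sumrB.
  rewrite (_ : \sum_i _ = M^-1 *
      \sum_i w 0 i * (if i \in I then z 0 i else `|z 0 i|)).
    by rewrite pmulr_rle0 ?invr_gt0.
  rewrite mulr_sumr; apply: eq_bigr => i _; rewrite -mulrBr mulrCA; congr (_ * _).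
  rewrite !mxE; case: ifP => iI; rewrite ?iI /=; last first.
    by rewrite mulr0n add0r normr0 subr0 normrM gtr0_norm ?invr_gt0.
  rewrite normr1 ger0_norm ?(addrC 1) ?addrK//.
  have : `|M^-1 * z 0 i| <= 1.
    rewrite normrM gtr0_norm ?invr_gt0// ler_pdivrMl// mulr1.
    by rewrite /M (bigD1 i)//= addrCA lerDl addr_ge0// sumr_ge0.
  by rewrite ler_norml => /andP[]; lra.
by rewrite big_ord1 scalerA mulfV ?gt_eqF// scale1r.
Qed.

Definition clip (l x : R) : R := Num.max (- l) (Num.min x l).

Lemma norm_clip_le (l x : R) : 0 <= l -> `|clip l x| <= l.
Proof.
move=> l0; rewrite ler_norml /clip le_max lexx/= ge_max ge_min lexx orbT andbT.
lra.
Qed.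

Lemma sub_clip_sqr (l x : R) : 0 <= l ->
  (x - clip l x) ^+ 2 = Num.max (`|x| - l) 0 ^+ 2.
Proof.
move=> l0; rewrite /clip; case: (lerP x l) => xl; case: (lerP (- l) _) => lx.
- by rewrite subrr max_r// subr_le0 ler_norml lx.
- rewrite ltr0_norm; last by lra.
  by rewrite max_l; [rewrite -sqrrN; congr (_ ^+ 2)|]; lra.
- rewrite gtr0_norm; last by lra.
  by rewrite max_l//; lra.
- by lra.
Qed.

(** The point of [tau] times the subdifferential closest to [x]. *)
Definition subgradient I w (tau : R) x : 'rV[R]_d :=
  \row_i (if i \in I then tau * w 0 i else clip (tau * w 0 i) (x 0 i)).

Lemma subgradient_polar I w tau x c : (forall i, 0 < w 0 i) -> 0 < tau ->
  polycone (sign_mx I w) c -> dot (subgradient I w tau x) c <= 0.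
Proof.
move=> w0 tau0 /(polycone_sign_mxP _ _ w0) Cc.
apply: (@le_trans _ _ (tau *
    \sum_i w 0 i * (if i \in I then c 0 i else `|c 0 i|))); last first.
  by rewrite pmulr_rle0.
rewrite dotE mulr_sumr; apply: ler_sum => i _; rewrite mxE mulrA.
case: ifP => // _; apply: le_trans (ler_norm _) _; rewrite normrM ler_wpM2r//.
by rewrite norm_clip_le// mulr_ge0// ltW.
Qed.

Definition tail_bound (l : R) : R := Num.sqrt (2 / pi) * truncated_moment 2 l.

Lemma stat_dim_descent_coneI_le I w tau : (forall i, 0 < w 0 i) -> 0 < tau ->
  stat_dim (descent_coneI I w) <=
  \sum_i (if i \in I then 1 + (tau * w 0 i) ^+ 2 else tail_bound (tau * w 0 i)).
Proof.
move=> w0 tau0; rewrite descent_coneI_polycone//.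
have l0 i : 0 <= tau * w 0 i by rewrite mulr_ge0// ltW.
rewrite -lee_fin; apply: le_trans (stat_dim_le_sqnorm2_proj _) _.
pose h i (x : R) : R := if i \in I then (x - tau * w 0 i) ^+ 2
  else Num.max (`|x| - tau * w 0 i) 0 ^+ 2.
have mh i : measurable_fun setT (h i).
  rewrite /h; case: (i \in I); apply: measurable_funX.
    exact: measurable_funB.
  apply: measurable_maxr => //; exact: measurable_funB.
have h0 i (r : R) : 0 <= h i r by rewrite /h; case: ifP => _; exact: sqr_ge0.
have mht i : measurable_fun setT (fun t : d.-tuple R => (h i (tnth t i))%:E).
  apply/measurable_EFinP; apply: (measurableT_comp (mh i)).
  exact: measurable_tnth.
apply: (@le_trans _ _
    (\int[std_normal_vec R d]_t \sum_(i < d) (h i (tnth t i))%:E)%E).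
  apply: ge0_le_integral => //.
  - by move=> t _; rewrite lee_fin sqnorm2_dot dot_ge0.
  - apply/measurable_EFinP; apply: measurable_sum => i; apply: measurable_funX.
    exact: measurable_proj.
  - by apply: emeasurable_sum => i; exact: mht.
  - move=> t _; rewrite sumEFin lee_fin.
    apply: le_trans (@sqnorm2_proj_le_dist_polar _ _ _ _ _
      (subgradient I w tau (row_of_tuple t)) _) _.
      by move=> c; exact: subgradient_polar.
    apply: ler_sum => i _; rewrite !mxE /h; case: ifP => // _.
    by rewrite sub_clip_sqr.
rewrite ge0_integral_sum//; last first.
  by move=> i t _; rewrite lee_fin.
rewrite -sumEFin le_eqVlt; apply/orP; left; apply/eqP; apply: eq_bigr => i _.
transitivity (\int[normal_prob 0 1]_r (h i r)%:E)%E.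
  apply: (@ge0_integral_iid_tnth _ _ _ (normal_prob 0 1) _ i
    (fun r : R => (h i r)%:E)) => [|r]; last by rewrite lee_fin.
  by apply/measurable_EFinP; exact: mh.
rewrite /h; case: (i \in I); first exact: normal_shifted_second_moment.
exact: normal_excess_moment.
Qed.

End descent.

(** * Averaging over the support *)

Section average.
Context {R : realType} {d : nat} {disp : measure_display}
  {Omega : measurableType disp}.
Variables (P : probability Omega R) (X0 : {RV P >-> d.-tuple R}).

Lemma measurable_supp_rv (I : {set 'I_d}) :
  measurable (supp_rv X0 @^-1` [set I]).
Proof.
rewrite (_ : _ @^-1` _ = \bigcap_(i in setT)
    [set omega | (tnth (X0 omega) i != 0) = (i \in I)]); last first.
  apply/seteqP; split => [omega <- i _|omega H] /=; first by rewrite inE mxE.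
  by apply/setP => i; rewrite inE mxE; exact: H.
apply: fin_bigcap_measurable => [|i _]; first exact: finite_finset.
have mX : measurable_fun setT (fun omega => tnth (X0 omega) i).
  apply: (measurableT_comp (f := fun t : d.-tuple R => tnth t i)) => //.
  exact: measurable_tnth.
have m0 : measurable [set omega | tnth (X0 omega) i == 0].
  rewrite (_ : [set _ | _] = setT `&` (fun omega => tnth (X0 omega) i) @^-1` [set 0]).
    exact: mX.
  by rewrite setTI; apply/seteqP; split => t /= /eqP.
have [iI|iI] := boolP (i \in I).
  rewrite (_ : [set _ | _] = ~` [set omega | tnth (X0 omega) i == 0]).
    exact: measurableC.
  by apply/seteqP; split => t /= /negP.
rewrite (_ : [set _ | _] = [set omega | tnth (X0 omega) i == 0])//.
by apply/seteqP; split => t /=; [move/negbFE|move=> ->].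
Qed.

Lemma expectation_supp_rv (f : {set 'I_d} -> R) :
  ('E_P[fun omega => f (supp_rv X0 omega)] =
   (\sum_(I : {set 'I_d}) f I * prob_supp X0 I)%:E)%E.
Proof.
have mI := measurable_supp_rv.
have E omega : f (supp_rv X0 omega) =
    \sum_(I : {set 'I_d}) f I * \1_(supp_rv X0 @^-1` [set I]) omega.
  rewrite (bigD1 (supp_rv X0 omega))//= indicE mem_set// mulr1 big1 ?addr0// => I Is.
  by rewrite indicE memNset ?mulr0//= => h; move: Is; rewrite h eqxx.
rewrite unlock; under eq_integral do rewrite E -sumEFin.
have intI I : P.-integrable setT (EFin \o \1_(supp_rv X0 @^-1` [set I])).
  by apply: integrable_indic => //; rewrite setIT ltry_prob.
rewrite integral_sum// => [|I]; last first.
  rewrite (_ : (fun _ => _) = fun x => ((f I)%:E *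
    (\1_(supp_rv X0 @^-1` [set I]) x)%:E)%E)//.
  by apply: integrableZl => //; exact: intI.
rewrite -sumEFin; apply: eq_bigr => I _.
under eq_integral do rewrite EFinM.
rewrite integralZl//; last exact: intI.
by rewrite integral_indic// setIT /prob_supp EFinM fineK// fin_num_measure.
Qed.

Lemma prob_supp_ge0 I : 0 <= prob_supp X0 I.
Proof. by rewrite /prob_supp fine_ge0. Qed.

Lemma sum_prob_supp : \sum_I prob_supp X0 I = 1.
Proof.
have := expectation_supp_rv (fun=> 1); rewrite expectation_cst => -[->].
by apply: eq_bigr => I _; rewrite mul1r.
Qed.

Lemma sum_prob_suppC i :
  \sum_(I : {set 'I_d} | i \notin I) prob_supp X0 I = 1 - beta X0 i.
Proof.
have := sum_prob_supp; rewrite (bigID (fun I : {set 'I_d} => i \in I))/= => <-.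
by rewrite /beta addrC addrK.
Qed.

Lemma upper_boundE w tau : upper_bound X0 w tau =
  (\sum_(I : {set 'I_d}) #|I|%:R * prob_supp X0 I + \sum_j
    (beta X0 j * (tau * w 0 j) ^+ 2 +
     (1 - beta X0 j) * tail_bound (tau * w 0 j)))%:E.
Proof.
rewrite /upper_bound (expectation_supp_rv (fun I => #|I|%:R)) EFinD.
by congr (_ + _)%E; rewrite -sumEFin.
Qed.

End average.

Theorem theorem2p7 (R : realType) (d : nat) (disp : measure_display)
    (Omega : measurableType disp) (P : probability Omega R)
    (X0 : {RV P >-> d.-tuple R})
    (hbeta : forall i : 'I_d, 0 < beta X0 i < 1) :
  (forall (w : 'rV[R]_d) (tau : R), (forall i, 0 < w 0 i) -> 0 < tau ->
     (expected_stat_dim X0 w <= upper_bound X0 w tau)%E) /\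
  (forall (w : 'rV[R]_d) (tau : R), (forall i, 0 < w 0 i) -> 0 < tau ->
     (forall i : 'I_d, let lambda := tau * w 0 i in
        lambda * (beta X0 i / (1 - beta X0 i)) =
        Num.sqrt (2 / pi) *
          \int[lebesgue_measure]_(u in `[lambda, +oo[)
             ((u - lambda) * expR (- (u ^+ 2) / 2))) ->
     forall (w' : 'rV[R]_d) (tau' : R), (forall i, 0 < w' 0 i) -> 0 < tau' ->
       (upper_bound X0 w tau <= upper_bound X0 w' tau')%E).
Proof.
have tw0 (w : 'rV[R]_d) (tau : R) i :
  (forall i, 0 < w 0 i) -> 0 < tau -> 0 <= tau * w 0 i.
  by move=> w0 tau0; rewrite mulr_ge0// ltW.
split=> [w tau w0 tau0|w tau w0 tau0 stationary w' tau' w'0 tau'0].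
  rewrite upper_boundE /expected_stat_dim.
  rewrite (expectation_supp_rv X0 (fun I => stat_dim (descent_coneI I w))) lee_fin.
  (* The contribution of coordinate [i] on the event that the support is [I],
     without the 1 that adds up to the size of [I]. *)
  pose g (I : {set 'I_d}) (i : 'I_d) := prob_supp X0 I *
    (if i \in I then (tau * w 0 i) ^+ 2 else tail_bound (tau * w 0 i)).
  apply: (@le_trans _ _ (\sum_(I : {set 'I_d})
      (#|I|%:R * prob_supp X0 I + \sum_i g I i))).
    apply: ler_sum => I _; rewrite /g -mulr_sumr [_ * prob_supp _ _]mulrC.
    rewrite [#|I|%:R * _]mulrC -mulrDr ler_wpM2l ?prob_supp_ge0//.
    apply: le_trans (stat_dim_descent_coneI_le I w0 tau0) _.
    rewrite -sum1_card natr_sum [X in _ <= X + _]big_mkcond.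
    rewrite -big_split/= le_eqVlt.
    apply/orP; left; apply/eqP; apply: eq_bigr => i _.
    by case: ifP => _; rewrite ?add0r.
  rewrite big_split lerD2l exchange_big/= le_eqVlt; apply/orP; left; apply/eqP.
  apply: eq_bigr => i _; rewrite (bigID (fun I : {set 'I_d} => i \in I))/=.
  congr (_ + _).
    by rewrite /beta mulr_suml; apply: eq_bigr => I iI; rewrite /g iI.
  rewrite -sum_prob_suppC mulr_suml; apply: eq_bigr => I iI.
  by rewrite /g (negbTE iI).
rewrite !upper_boundE lee_fin lerD2l; apply: ler_sum => j _.
have /andP[b0 b1] := hbeta j.
have : tau * w 0 j * (beta X0 j / (1 - beta X0 j)) =
  Num.sqrt (2 / pi) * truncated_moment 1 (tau * w 0 j) by exact: stationary.
have := truncated_moment_tangent (tw0 _ _ j w0 tau0) (tw0 _ _ j w'0 tau'0).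
rewrite /tail_bound; move: (tau * w 0 j) (tau' * w' 0 j) => l l'.
move: (truncated_moment 1 l) (truncated_moment 2 l) (truncated_moment 2 l').
move: (Num.sqrt (2 / pi)) (sqrtr_ge0 (2 / pi : R)) (beta X0 j) b0 b1.
move=> c c0 b b0 b1 m1 m2 m2' tangent stat.
have b1' : 0 < 1 - b by rewrite subr_gt0.
have {stat}stat : l * b = (1 - b) * (c * m1).
  by rewrite -stat; field; rewrite gt_eqF.
have : (1 - b) * c * (m2 - 2 * (l' - l) * m1) <= (1 - b) * c * m2'.
  by rewrite ler_wpM2l// mulr_ge0// ltW.
(* The part [b l^2] of the function lies above its tangent at [l] by exactly
   this amount; the linear terms of the two tangents cancel by [stat]. *)
have : 0 <= b * (l' - l) ^+ 2 by rewrite mulr_ge0 ?sqr_ge0// ltW.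
have : (l' - l) * (l * b) = (l' - l) * ((1 - b) * (c * m1)) by rewrite stat.
rewrite !expr2; lra.
Qed.
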